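(* Let $F$ be a field and $F * A_1$, $F * A_2$ twisted group algebras of finitely generated free abelian groups $A_1,A_2$ over $F$, and suppose $\dim(F * A_i)<\mathrm{rk}(A_i)$ for $i\in\{1,2\}$. Let $d=\dim(F * A_1\otimes_F F * A_2)$. Then $$d\le\min\{\dim(F * A_1)+\mathrm{rk}(A_2),\ \dim(F * A_2)+\mathrm{rk}(A_1)\}-1.$$
   Context: A twisted group algebra $F * A$ is an $F$-algebra with $F$-basis $\{\bar a: a\in A\}$ and $\bar a_1\bar a_2=\tau(a_1,a_2)\overline{a_1a_2}$, $\tau$ a 2-cocycle with values in $F\setminus\{0\}$. The tensor product $F * A_1\otimes_F F * A_2$ is a twisted group algebra of $A_1\times A_2$. $\dim$ denotes the Krull dimension, which for these algebras coincides with the global dimension; $\mathrm{rk}$ denotes the rank of a free abelian group. *)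

(* Defs.v *)
From HB Require Import structures.
From mathcomp Require Import all_boot all_order all_algebra.
Set Implicit Arguments. Unset Strict Implicit. Unset Printing Implicit Defensive.
Import GRing.Theory.
Local Open Scope ring_scope.

Definition is_Fbasis (F : fieldType) (R : algType F) (A : eqType) (u : A -> R) : Prop :=
  (forall (s : seq A) (c : A -> F), uniq s ->
      \sum_(a <- s) c a *: u a = 0 -> forall a, a \in s -> c a = 0) /\
  (forall x : R, exists (s : seq A) (c : A -> F), x = \sum_(a <- s) c a *: u a).

Definition is_twisted_group_algebra (F : fieldType) (A : zmodType) (R : algType F)
  (tau : A -> A -> F) (u : A -> R) : Prop :=
  (forall a b, tau a b != 0) /\ is_Fbasis u /\
  (forall a b, u a * u b = tau a b *: u (a + b)).

(** The product cocycle on A1 x A2, which gives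
    F * A1 (x)_F F * A2 as a twisted group algebra of A1 x A2. *)
Definition prod_cocycle (F : fieldType) (A1 A2 : zmodType)
  (tau1 : A1 -> A1 -> F) (tau2 : A2 -> A2 -> F) : A1 * A2 -> A1 * A2 -> F :=
  fun a b => tau1 a.1 b.1 * tau2 a.2 b.2.

Definition right_ideal (R : ringType) (I : R -> Prop) : Prop :=
  I 0 /\ (forall x y, I x -> I y -> I (x + y)) /\ (forall x r, I x -> I (x * r)).

Definition subI (R : ringType) (I J : R -> Prop) : Prop := forall x, I x -> J x.

(** Deviation (Gabriel–Rentschler Krull dimension) of the interval [B, A]
    in the lattice of right ideals, with natural-number bounds:
    [dev_lt k B A] means dev [B,A] <= k - 1, where dev = -infinity means
    the interval is trivial.  So [dev_lt 0 B A] iff A ⊆ B, and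
    [dev_lt k.+1 B A] iff every descending chain of right ideals in [B,A]
    has all but finitely many factors of deviation <= k - 1. *)
Fixpoint dev_lt (R : ringType) (k : nat) (B A : R -> Prop) : Prop :=
  match k with
  | 0 => subI A B
  | k'.+1 => forall c : nat -> (R -> Prop),
      (forall i, right_ideal (c i)) ->
      (forall i, subI B (c i) /\ subI (c i) A) ->
      (forall i, subI (c i.+1) (c i)) ->
      exists N, forall i, (N <= i)%N -> dev_lt k' (c i.+1) (c i)
  end.

Definition kdim_le (R : ringType) (k : nat) : Prop :=
  dev_lt k.+1 (fun x : R => x = 0) (fun _ : R => True).

Definition krull_dim (R : ringType) (k : nat) : Prop :=
  kdim_le R k /\ forall j, (j < k)%N -> ~ kdim_le R j.

(* Main.v *)
(** Write [m = n2 - k2].  It suffices to find, in every nonzero cyclic module over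
    the tensor product [T], a family of monomial multiples of one element that is
    linearly independent and indexed by [N^(m+1)]: passing to leading monomials,
    right ideals of [T] become up-sets of a free commutative monoid, and the
    deviation is bounded by a count of free directions (Dickson's lemma).

    For [F * A2], the bound [k2] on the Krull dimension gives such families indexed
    by [N^m].  Indeed, Noether normalization makes a nonzero cyclic module [M] finitely
    generated over [F * C], with [F * C] embedded in [M], and divided-power
    derivations in the remaining [rk (A2 / C)] directions embed the up-sets of
    [N^(rk (A2 / C))] into a finite power of the lattice of right ideals, so
    [rk (A2 / C) <= k2].

    Since [k1 < n1], some monomials [x], [y] of [F * A1] satisfy [x y = q y x] with [q]
    not a root of unity.  If some element of the module is killed by a nonzero
    polynomial in [x], choose [p] of minimal degree among these polynomials; the powers
    of [y] then move the element to the kernels of the pairwise distinct polynomials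
    [p (q^l x)] of the same degree, and [y] supplies the extra direction.
    Otherwise generic freeness over [F[x]] (the key step in Quillen's lemma)
    specializes the module at a polynomial [p] to a nonzero module over [F * A2]; its
    growth forces the generic basis of monomials to contain some [N^m], and [x]
    supplies the extra direction. *)

Require Import Defs.
From HB Require Import structures.
From mathcomp Require Import all_boot all_order all_algebra.
From mathcomp Require Import zify ring.
From mathcomp Require Import mpoly.
From Stdlib Require Import Classical ClassicalEpsilon.
Set Implicit Arguments. Unset Strict Implicit. Unset Printing Implicit Defensive.
Import Order.TTheory GRing.Theory Num.Theory.
Local Open Scope ring_scope.

(** * Monomial exponents *)

Section Dickson.
Local Open Scope nat_scope.

Definition increasing (phi : nat -> nat) := forall i j, i < j -> phi i < phi j.

Lemma increasing_leq phi : increasing phi -> forall i j, i <= j -> phi i <= phi j.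
Proof.
by move=> inc i j; rewrite leq_eqVlt => /orP[/eqP->//|/inc/ltnW].
Qed.

Lemma increasing_enum (P : nat -> Prop) :
  (forall k, exists i, k <= i /\ P i) ->
  exists phi, increasing phi /\ forall i, P (phi i).
Proof.
move=> H.
pose nxt k := proj1_sig (constructive_indefinite_description _ (H k)).
have nxtP k : k <= nxt k /\ P (nxt k).
  exact: (proj2_sig (constructive_indefinite_description _ (H k))).
pose phi := fix phi i := if i is i'.+1 then nxt (phi i').+1 else nxt 0.
exists phi; split; last by case=> [|i]; apply: (nxtP _).2.
have step i : phi i < phi i.+1 by apply: (nxtP _).1.
by move=> i j; elim: j => // j IH; rewrite ltnS leq_eqVlt => /orP[/eqP->//|/IH/ltn_trans]; apply.
Qed.

(** Indices whose value is at most every later value occur arbitrarily late; they form the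
    subsequence. *)
Lemma nat_monotone_subseq (g : nat -> nat) :
  exists phi, increasing phi /\ forall i j, i <= j -> g (phi i) <= g (phi j).
Proof.
have [phi [inc phiP]] : exists phi, increasing phi /\
    forall i, forall j, phi i <= j -> g (phi i) <= g j.
  apply: (@increasing_enum (fun i => forall j, i <= j -> g i <= g j)) => k.
  have: exists i, k <= i /\ g i <= g k by exists k.
  move: (g k) => c; elim: c => [|c IH] [i [ki gi]].
    by exists i; split=> // j _; apply: leq_trans gi _.
  case: (classic (exists i, k <= i /\ g i <= c)) => [/IH//|N].
  exists i; split=> // j ij; apply: leq_trans gi _; rewrite ltnNge; apply/negP => lt.
  by apply: N; exists j; split=> //; apply: leq_trans ij.
exists phi; split=> // i j ij; apply: phiP; exact: increasing_leq.
Qed.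

Lemma monotone_subseq (f : nat -> nat -> nat) n :
  exists phi, increasing phi /\
    forall l, l < n -> forall i j, i <= j -> f (phi i) l <= f (phi j) l.
Proof.
elim: n => [|n [phi [inc phiP]]]; first by exists id; split.
have [psi [inc' psiP]] := nat_monotone_subseq (fun i => f (phi i) n).
exists (phi \o psi); split; first by move=> i j /inc'/inc.
move=> l; rewrite ltnS leq_eqVlt => /orP[/eqP-> i j ij|ln i j ij]; first exact: psiP.
by apply: phiP => //; apply: increasing_leq.
Qed.

Variable n : nat.
Implicit Types (s t v : 'X_{1..n}) (U V : 'X_{1..n} -> Prop).

Definition upset U := forall s t, U s -> U (s + t)%MM.

Lemma upset_le U s t : upset U -> (s <= t)%MM -> U s -> U t.
Proof. by move=> up st /(up _ (t - s)%MM); rewrite addmC submK. Qed.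

(** Dickson's lemma. Otherwise elements of [U] lying above no earlier choice could be chosen
    forever, but every such sequence has a coordinatewise monotone subsequence. *)
Lemma upset_fingen U : upset U ->
  exists L : seq 'X_{1..n}, (forall s, s \in L -> U s) /\
    forall s, U s -> exists2 t, t \in L & (t <= s)%MM.
Proof.
move=> up; apply: NNPP => H.
have new (L : seq (multinom n)) : (forall s, s \in L -> U s) ->
    exists s, U s /\ forall t, t \in L -> ~~ (t <= s)%MM.
  move=> LU; apply: NNPP => N; apply: H; exists L; split=> // s Us.
  apply: NNPP => N2; apply: N; exists s; split=> // t tL; apply/negP => ts.
  by apply: N2; exists t.
pose good (L : seq (multinom n)) := forall s, s \in L -> U s.
have nxtex (L : seq (multinom n)) : exists s, good L -> U s /\ forall t, t \in L -> ~~ (t <= s)%MM.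
  by case: (classic (good L)) => [/new[s Hs]|N]; [exists s|exists 0%MM].
pose nxt L := proj1_sig (constructive_indefinite_description _ (nxtex L)).
have nxtP L : good L -> U (nxt L) /\ forall t, t \in L -> ~~ (t <= nxt L)%MM.
  exact: (proj2_sig (constructive_indefinite_description _ (nxtex L))).
pose Ls := fix Ls i := if i is i'.+1 then nxt (Ls i') :: Ls i' else [::].
have goodL i : good (Ls i).
  elim: i => // i IH s; rewrite inE => /orP[/eqP->|]; last exact: IH.
  by case: (nxtP _ IH).
have mem i j : i < j -> nxt (Ls i) \in Ls j.
  elim: j => // j IH; rewrite ltnS leq_eqVlt inE => /orP[/eqP->|/IH->]; rewrite ?eqxx ?orbT //.
pose f i l := if insub l is Some l' then nxt (Ls i) (l' : 'I_n) else 0.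
have [phi [inc phiP]] := monotone_subseq f n.
have [_ /(_ _ (mem _ _ (inc 0 1 isT)))/negP[]] := nxtP _ (goodL (phi 1)).
apply/mnm_lepP => i; have := phiP i (ltn_ord i) 0 1 isT.
by rewrite /f valK.
Qed.

Definition has_cone (D : 'X_{1..n} -> Prop) (S : {set 'I_n}) v :=
  forall t, (forall i, i \notin S -> t i = 0) -> D (v + t)%MM.

Definition has_cone_dim (D : 'X_{1..n} -> Prop) e :=
  exists (S : {set 'I_n}) v, #|S| = e /\ has_cone D S v.

Definition diff U V s := U s /\ ~ V s.

Lemma cone_dim_chain (c : nat -> 'X_{1..n} -> Prop) U V e :
  upset U -> upset V ->
  (forall i s, V s -> c i s) -> (forall i s, c i s -> U s) ->
  (forall i s, c i.+1 s -> c i s) ->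
  ~ has_cone_dim (diff U V) e.+1 ->
  exists N, forall i, N <= i -> ~ has_cone_dim (diff (c i) (c i.+1)) e.
Proof.
move=> upU upV Vc cU dec noU; apply: NNPP => H; apply: noU.
have dec' i j s : i <= j -> c j s -> c i s.
  by move/subnK <-; elim: (j - i) => // d IH /dec/IH.
have inf k : exists i, k <= i /\ has_cone_dim (diff (c i) (c i.+1)) e.
  apply: NNPP => N; apply: H; exists k => i ki hc; apply: N; by exists i.
have [phi [inc phiP]] := increasing_enum inf.
pose Sv i := constructive_indefinite_description _ (phiP i).
pose S i := proj1_sig (Sv i).
pose wv i := constructive_indefinite_description _ (proj2_sig (Sv i)).
pose w i := proj1_sig (wv i).
have SwP i : #|S i| = e /\ has_cone (diff (c (phi i)) (c (phi i).+1)) (S i) (w i).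
  exact: (proj2_sig (wv i)).
(* the two indicator blocks make [S] constant along a monotone subsequence *)
pose f i l := if insub l is Some l' then w i (l' : 'I_n)
  else if insub (l - n) is Some l' then ((l' : 'I_n) \in S i : nat)
  else if insub (l - n - n) is Some l' then ((l' : 'I_n) \notin S i : nat) else 0.
have [psi [inc' psiP]] := monotone_subseq f (n + n + n).
pose S0 := S (psi 0).
pose x i := w (psi i).
have xmono i j l : i <= j -> x i l <= x j l.
  move=> ij; have := psiP l; rewrite /f valK => /(_ _ _ _ ij); apply.
  by rewrite -addnA; apply: leq_trans (ltn_ord l) (leq_addr _ _).
have Sc i : S (psi i) = S0.
  apply/setP => l.
  have h1 : (l \in S (psi 0)) <= (l \in S (psi i)).
    have := psiP (n + l); rewrite /f insubF; last by rewrite ltnNge leq_addr.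
    rewrite addKn valK => /(_ _ 0 i isT); apply.
    by rewrite -addnA ltn_add2l; apply: leq_trans (ltn_ord l) (leq_addr _ _).
  have h2 : (l \notin S (psi 0)) <= (l \notin S (psi i)).
    have := psiP (n + n + l); rewrite /f insubF; last by rewrite ltnNge -addnA leq_addr.
    rewrite insubF; last by rewrite -addnA addKn ltnNge leq_addr.
    rewrite -addnA addKn addKn valK => /(_ _ 0 i isT); apply.
    by rewrite addnA ltn_add2l.
  by move: h1 h2; rewrite /S0; case: (l \in S _); case: (l \in S _).
have cone i : has_cone (diff (c (phi (psi i))) (c (phi (psi i)).+1)) S0 (x i).
  by rewrite -(Sc i); apply: (SwP _).2.
(* If the apexes agreed outside [S0], the later one would lie in the earlier cone, which avoids
   [c (phi (psi i)).+1]; but the chain decreases, so that set contains the later apex. *)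
have grow i : exists2 l, l \notin S0 & x i l < x i.+1 l.
  apply: NNPP => N.
  have: c (phi (psi i)).+1 (x i.+1).
    apply: (dec' _ (phi (psi i.+1))); first by apply/inc/inc'.
    by have [] := cone i.+1 0%MM (fun l _ => mnm0E l); rewrite addm0.
  have le : (x i <= x i.+1)%MM by apply/mnm_lepP => l; apply: xmono.
  rewrite -(submK le) addmC; apply: (cone i _ _).2 => l lS.
  rewrite mnmBE; apply/eqP; rewrite subn_eq0 leqNgt; apply/negP => lt.
  by apply: N; exists l.
have [l lS lP] : exists2 l, l \notin S0 & forall b, exists i, b <= x i l.
  apply: NNPP => N.
  have bd l : exists b, l \notin S0 -> forall i, x i l < b.
    apply: NNPP => N2; apply: N; exists l.
      by apply: NNPP => N3; apply: N2; exists 0 => /N3.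
    move=> b; apply: NNPP => N3; apply: N2; exists b => _ i.
    by rewrite ltnNge; apply/negP => bx; apply: N3; exists i.
  pose bb l := proj1_sig (constructive_indefinite_description _ (bd l)).
  have bbP l : l \notin S0 -> forall i, x i l < bb l.
    exact: (proj2_sig (constructive_indefinite_description _ (bd l))).
  have sumge i : i <= \sum_(l | l \notin S0) x i l.
    elim: i => // i IH; apply: leq_ltn_trans IH _.
    have [l lS lt] := grow i.
    rewrite (bigD1 l) //= [X in _ < X](bigD1 l) //= -addSn; apply: leq_add => //.
    by apply: leq_sum => l' _; apply: xmono.
  pose b := \sum_(l | l \notin S0) bb l.
  have := sumge b.+1; rewrite leqNgt => /negP; apply.
  by rewrite ltnS; apply: leq_sum => l lS; apply/ltnW/bbP.
exists (l |: S0), (x 0); split; first by rewrite cardsU1 lS /= (SwP _).1.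
move=> t tS; split.
  apply: upU; apply: (cU (phi (psi 0))).
  by have [] := cone 0 0%MM (fun l _ => mnm0E l); rewrite addm0.
move=> Vt; have [i iP] := lP (x 0 l + t l).
(* Only the part of [t] along [S0] is kept: as [x i] is already large at [l], the point [x i + t']
   dominates [x 0 + t], so it would lie in [V] although it belongs to the cone at [x i]. *)
pose t' := [multinom (if k \in S0 then t k else 0) | k < n]%MM.
have t'S k : k \notin S0 -> t' k = 0 by move=> kS; rewrite mnmE (negbTE kS).
apply: (cone i t' t'S).2; apply: Vc; apply: upset_le Vt => //; apply/mnm_lepP => k.
rewrite !mnmE; case: ifP => kS; first by rewrite leq_add2r xmono.
rewrite addn0; case: (eqVneq k l) => [->//|kl].
by rewrite tS ?addn0 ?xmono // !inE negb_or kl kS.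
Qed.

End Dickson.

(** * Growth of monomial sets *)

Section Counting.
Local Open Scope nat_scope.
Variable n : nat.
Implicit Types (s t v : 'X_{1..n}) (U V : 'X_{1..n} -> Prop).

Lemma subset_of_card (T : finType) (Q : {set T}) e :
  e <= #|Q| -> exists2 S : {set T}, S \subset Q & #|S| = e.
Proof.
move=> le; exists [set x in take e (enum Q)].
  by apply/subsetP => x; rewrite inE => /mem_take; rewrite mem_enum.
rewrite cardsE; have /card_uniqP-> : uniq (take e (enum Q)) by rewrite take_uniq ?enum_uniq.
by rewrite size_take -cardE; case: ltngtP le.
Qed.

(** Outside [V] fewer than [e] coordinates can exceed a fixed bound, so the count is of order
    [R ^ (e - 1)]. The extra factor [R.+1] on the left avoids subtraction and makes the case [e = 0]
    say that there are no such points. *)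
Lemma downset_count V e : upset V ->
  (forall S : {set 'I_n}, #|S| = e ->
     exists t, (forall i, i \notin S -> t i = 0) /\ V t) ->
  exists K, forall R, exists L : seq 'X_{1..n},
    R.+1 * size L <= K * R.+1 ^ e /\ forall s, ~ V s -> mdeg s <= R -> s \in L.
Proof.
case: e => [|e] up H.
  have [t [t0 Vt]] := H set0 (cards0 _).
  exists 0 => R; exists [::]; split=> [|s []]; first by rewrite muln0.
  apply: upset_le Vt => //.
  by apply/mnm_lepP => i; rewrite t0 // inE.
have H' (S : {set 'I_n}) : exists t, #|S| = e.+1 ->
    (forall i, i \notin S -> t i = 0) /\ V t.
  by case: (#|S| =P e.+1) => [/H[t tP]|N]; [exists t|exists 0%MM].
pose t S := proj1_sig (constructive_indefinite_description _ (H' S)).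
have tP (S : {set 'I_n}) : #|S| = e.+1 -> (forall i, i \notin S -> t S i = 0) /\ V (t S).
  exact: (proj2_sig (constructive_indefinite_description _ (H' S))).
pose M := \max_S mdeg (t S).
have few s : ~ V s -> #|[set i | M < s i]| <= e.
  move=> Vs; rewrite leqNgt; apply/negP => /subset_of_card[S SQ cS].
  apply: Vs; have [t0 Vt] := tP _ cS; apply: upset_le Vt => //.
  apply/mnm_lepP => i; case: (boolP (i \in S)) => [iS|/t0->//].
  have : t S i <= M.
    apply: (@leq_trans (mdeg (t S))); last exact: (leq_bigmax (F := fun S => mdeg (t S))).
    by rewrite mdegE (bigD1 i) //= leq_addr.
  by move/leq_trans; apply; have := subsetP SQ _ iS; rewrite inE => /ltnW.
exists (n.+1 ^ e * M.+1 ^ n) => R.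
(* An exponent is encoded by the positions of its large coordinates, the values of all other
   coordinates (at most [M]) and the values of the large ones (at most [R]). *)
pose mk (x : {ffun 'I_e -> option 'I_n} * {ffun 'I_n -> 'I_M.+1} * {ffun 'I_e -> 'I_R.+1}) :=
  [multinom (if [pick j | x.1.1 j == Some i] is Some j then nat_of_ord (x.2 j)
             else nat_of_ord (x.1.2 i)) | i < n]%MM.
exists (codom mk); split.
  rewrite size_codom !card_prod !card_ffun !card_ord card_option card_ord expnS.
  by rewrite mulnCA leq_mul.
move=> s Vs sR; apply/codomP.
pose Q := [set i | M < s i].
pose f := [ffun j : 'I_e => nth None (map Some (enum Q)) j].
pose b := [ffun j : 'I_e => inord (if f j is Some i then s i else 0) : 'I_R.+1].
exists (f, [ffun i => inord (s i)], b); apply/mnmP => i; rewrite mnmE /=.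
case: pickP => [j /eqP fj|nof].
  rewrite ffunE fj inordK //.
  by rewrite ltnS; apply: leq_trans sR; rewrite mdegE (bigD1 i) //= leq_addr.
rewrite ffunE inordK // ltnNge; apply/negP => Ms.
have iQ : i \in enum Q by rewrite mem_enum inE.
have lt : index i (enum Q) < e.
  by apply: leq_trans (few _ Vs); rewrite cardE index_mem.
have := nof (Ordinal lt); rewrite ffunE /= (nth_map i) ?index_mem //.
by rewrite nth_index // eqxx.
Qed.

(** By Dickson's lemma [U] is a finite union of translates [g + N^n]; on each of them the absence of
    a cone is the hypothesis of [downset_count]. *)
Lemma diff_count U V e : upset U -> upset V -> ~ has_cone_dim (diff U V) e ->
  exists K, forall R, exists L : seq 'X_{1..n},
    R.+1 * size L <= K * R.+1 ^ e /\ forall s, diff U V s -> mdeg s <= R -> s \in L.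
Proof.
move=> upU upV nc; have [G [GU Ggen]] := upset_fingen upU.
suff [K KP] : exists K, forall R, exists L : seq 'X_{1..n},
    R.+1 * size L <= K * R.+1 ^ e /\ forall s, (exists2 g, g \in G & (g <= s)%MM) ->
      ~ V s -> mdeg s <= R -> s \in L.
  exists K => R; have [L [szL LP]] := KP R; exists L; split=> // s [Us Vs].
  by apply: LP => //; apply: Ggen.
elim: G GU {Ggen} => [|g G IH] GU.
  by exists 0 => R; exists [::]; split; [rewrite muln0|move=> s [g]].
have [|K KP] := IH; first by move=> s sG; apply: GU; rewrite inE sG orbT.
have [||K' KP'] := @downset_count (fun t => V (g + t)%MM) e.
- by move=> s t Vs; rewrite addmA; apply: upV.
- move=> S cS; apply: NNPP => N; apply: nc; exists S, g; split=> // t tS; split.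
    by apply: upU; apply: GU; rewrite mem_head.
  by move=> Vt; apply: N; exists t.
exists (K' + K) => R; have [L [szL LP]] := KP R; have [L' [szL' LP']] := KP' R.
exists ([seq (g + t)%MM | t <- L'] ++ L); split.
  by rewrite size_cat size_map mulnDr mulnDl leq_add.
move=> s [h hG hs] Vs sR; rewrite mem_cat; apply/orP.
move: hG; rewrite inE => /orP[/eqP hg|hG]; last by right; apply: LP => //; exists h.
rewrite hg in hs; left; rewrite -(submK hs) addmC; apply/mapP; exists (s - g)%MM => //.
apply: LP'; first by rewrite addmC submK.
by apply: leq_trans sR; apply: mdegB.
Qed.

End Counting.

(** * Spans and linear independence modulo a subspace *)

Section Span.
Variables (F : fieldType) (V : lmodType F).
Implicit Types (B X Y : V -> Prop).

Definition subspace B :=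
  [/\ B 0, forall x y, B x -> B y -> B (x + y) & forall c x, B x -> B (c *: x)].

Inductive lspan X : V -> Prop :=
| lspan0 : lspan X 0
| lspanS c x y : X x -> lspan X y -> lspan X (c *: x + y).

Lemma lspan_min X B : subspace B -> (forall x, X x -> B x) -> forall x, lspan X x -> B x.
Proof.
move=> [B0 BD BZ] XB x; elim=> // c {}x y Xx _ By.
by apply: BD => //; apply/BZ/XB.
Qed.

Lemma lspan_gen X x : X x -> lspan X x.
Proof. by move=> Xx; rewrite -[x]scale1r -[_ *: _]addr0; apply: lspanS => //; apply: lspan0. Qed.

Lemma lspanD X x y : lspan X x -> lspan X y -> lspan X (x + y).
Proof. by elim=> [|c {}x z Xx _ IH] Xy; rewrite ?add0r // -addrA; apply: lspanS => //; apply: IH. Qed.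

Lemma lspanZ X c x : lspan X x -> lspan X (c *: x).
Proof.
elim=> [|d {}x z Xx _ IH]; first by rewrite scaler0; apply: lspan0.
by rewrite scalerDr scalerA; apply: lspanS.
Qed.

Lemma lspan_subspace X : subspace (lspan X).
Proof. split; [exact: lspan0|exact: lspanD|exact: lspanZ]. Qed.

Lemma lspan_sub X Y : (forall x, X x -> lspan Y x) -> forall x, lspan X x -> lspan Y x.
Proof. by apply: lspan_min; apply: lspan_subspace. Qed.

Lemma subspaceN B x : subspace B -> B x -> B (- x).
Proof. by move=> [_ _ BZ]; rewrite -scaleN1r; apply: BZ. Qed.

Lemma subspaceB B x y : subspace B -> B x -> B y -> B (x - y).
Proof. by move=> sB Bx By; have [_ BD _] := sB; apply: BD => //; apply: subspaceN. Qed.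

Lemma subspaceZ B c x : subspace B -> c != 0 -> B (c *: x) -> B x.
Proof. by move=> [_ _ BZ] c0 /(BZ c^-1); rewrite scalerA mulVf // scale1r. Qed.

Lemma subspace_sum B I (r : seq I) (P : pred I) (f : I -> V) :
  subspace B -> (forall i, P i -> B (f i)) -> B (\sum_(i <- r | P i) f i).
Proof. by move=> [B0 BD _] Bf; apply: big_ind. Qed.

Lemma subspace_sum_seq B (I : eqType) (r : seq I) (f : I -> V) :
  subspace B -> (forall i, i \in r -> B (f i)) -> B (\sum_(i <- r) f i).
Proof. by move=> [B0 BD _] Bf; rewrite big_seq; apply: big_ind. Qed.

Definition indep B (K : eqType) (x : K -> V) :=
  forall (L : seq K) (c : K -> F), uniq L ->
    B (\sum_(k <- L) c k *: x k) -> forall k, k \in L -> c k = 0.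

Lemma lspan_seq_coef B (Y : seq V) x : subspace B ->
  lspan (fun y => B y \/ y \in Y) x ->
  exists c : nat -> F, B (x - \sum_(j < size Y) c j *: Y`_j).
Proof.
move=> sB; have [B0 BD BZ] := sB; elim=> [|c {}x y Xx _ [d dP]].
  by exists (fun _ => 0); rewrite big1 ?subr0 // => j _; rewrite scale0r.
case: Xx => [Bx|xY].
  by exists d; rewrite -addrA; apply: BD => //; apply: BZ.
exists (fun j => d j + (if j == index x Y then c else 0)).
have lt : (index x Y < size Y)%N by rewrite index_mem.
under eq_bigr do rewrite scalerDl.
rewrite big_split /= opprD [c *: x + y]addrC addrACA; suff -> : c *: x -
   \sum_(i < size Y) (if i == index x Y :> nat then c else 0) *: Y`_i = 0 by rewrite addr0.
rewrite (bigD1 (Ordinal lt)) //= eqxx nth_index // big1 ?addr0 ?subrr // => j jn.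
by rewrite ifN ?scale0r //; apply: contra jn => /eqP e; apply/eqP/val_inj.
Qed.

(** Steinitz bound modulo [B]: a coefficient matrix with more rows than columns has a nonzero vector
    in its left kernel, which is a dependency. *)
Lemma indep_size_le B (K : eqType) (x : K -> V) (L : seq K) (Y : seq V) :
  subspace B -> indep B x -> uniq L ->
  (forall k, k \in L -> lspan (fun y => B y \/ y \in Y) (x k)) ->
  (size L <= size Y)%N.
Proof.
move=> sB ix uL LY; rewrite leqNgt; apply/negP => lt.
case: L => [//|k0 L0] in uL LY lt *; set L := k0 :: L0 in uL LY lt *.
have ex k : exists c : nat -> F, k \in L -> B (x k - \sum_(j < size Y) c j *: Y`_j).
  case: (boolP (k \in L)) => [/LY/(lspan_seq_coef sB)[c cP]|_]; first by exists c.
  by exists (fun _ => 0).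
pose c k := proj1_sig (constructive_indefinite_description _ (ex k)).
have cP k : k \in L -> B (x k - \sum_(j < size Y) c k j *: Y`_j).
  exact: (proj2_sig (constructive_indefinite_description _ (ex k))).
pose M := \matrix_(i < size L, j < size Y) c (nth k0 L i) j.
have : kermx M != 0.
  rewrite kermx_eq0 /row_free; apply/eqP => e.
  by have := rank_leq_col M; rewrite e leqNgt lt.
case/rowV0Pn => z /sub_kermxP zM /eqP z0; apply: z0; apply/rowP => i; rewrite mxE.
pose z' k := if insub (index k L) is Some i then z 0 (i : 'I_(size L)) else 0.
have z'E (j : 'I_(size L)) : z' (nth k0 L j) = z 0 j by rewrite /z' index_uniq // valK.
rewrite -z'E; apply: (ix L z') => //; last exact: mem_nth.
have -> : \sum_(k <- L) z' k *: x k =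
   \sum_(k <- L) z' k *: (x k - \sum_(j < size Y) c k j *: Y`_j).
  apply/eqP; rewrite -subr_eq0 -sumrB; apply/eqP.
  under eq_bigr do rewrite -scalerBr opprB addrC addrNK scaler_sumr.
  rewrite exchange_big /= big1 // => j _.
  transitivity ((z *m M) 0 j *: Y`_j); last by rewrite zM mxE scale0r.
  rewrite mxE scaler_suml (big_nth k0) big_mkord; apply: eq_bigr => i' _.
  by rewrite z'E mxE scalerA.
apply: subspace_sum_seq => // k kL; have [_ _ BZ] := sB; exact/BZ/cP.
Qed.

(** Growth comparison: [(r+1)^e] independent vectors cannot fit into the span of [d] vectors for
    each exponent of degree [O(r)], if the number of those exponents is only [O(r^(e-1))]. *)
Lemma cone_of_growth n (U W : 'X_{1..n} -> Prop) e B (K : eqType) (x : K -> V)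
    (L : nat -> seq K) (Y : 'X_{1..n} -> nat -> V) (c d : nat) :
  upset U -> upset W -> subspace B -> indep B x ->
  (forall r, uniq (L r) /\ size (L r) = (r.+1 ^ e)%N) ->
  (forall r k, k \in L r -> lspan (fun y => B y \/ exists s l,
      [/\ diff U W s, mdeg s <= c * r.+1, l < d & y = Y s l]%N) (x k)) ->
  has_cone_dim (diff U W) e.
Proof.
move=> upU upW sB ix uL LY; apply: NNPP => nc.
have [Q QP] := diff_count upU upW nc.
pose r := (Q * (c.+2) ^ e * d)%N; have [uLr szL] := uL r.
have [S [szS SP]] := QP (c * r.+1 + r)%N.
have := @indep_size_le B K x (L r) [seq Y s l | s <- S, l <- iota 0 d] sB ix uLr.
have -> : size [seq Y s l | s <- S, l <- iota 0 d] = (size S * d)%N.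
  by rewrite size_allpairs size_iota.
move=> /(_ _)/[!szL] le; have {}le : (r.+1 ^ e <= size S * d)%N.
  apply: le => k kL; apply: lspan_sub (LY _ _ kL) => y [By|[s [l [Ds ds ld ->]]]].
    by apply: lspan_gen; left.
  apply: lspan_gen; right; apply/allpairsP; exists (s, l) => /=; split=> //.
    by apply: SP => //; apply: leq_trans ds (leq_addr _ _).
  by rewrite mem_iota.
have h : ((c * r.+1 + r).+1 <= c.+2 * r.+1)%N by lia.
have h2 : ((c * r.+1 + r).+1 ^ e <= (c.+2) ^ e * r.+1 ^ e)%N.
  by rewrite -expnMn; case: (e) => // e'; rewrite leq_exp2r.
have := leq_mul (leqnn (c * r.+1 + r).+1) le.
rewrite mulnA => /leq_trans/(_ (leq_mul szS (leqnn d))).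
have h3 : (Q * (c * r.+1 + r).+1 ^ e * d <= r * r.+1 ^ e)%N.
  rewrite /r mulnAC [X in (_ <= X)%N]mulnC mulnA -/r.
  apply: leq_trans (leq_mul (leqnn (Q * d)) h2) _; rewrite /r; lia.
move=> /leq_trans/(_ h3); rewrite leq_mul2r expn_eq0 /= ltnNge leq_addl //.
Qed.

End Span.

(** * Twisted group algebras *)

Section Families.
Variables (F : fieldType) (K : eqType).

Lemma sum_pairs_merge (Z V : zmodType) (f : K -> Z -> V) (l : seq (Z * K)) :
  (forall k, f k 0 = 0) -> (forall k, {morph f k : x y / x + y}) ->
  \sum_(p <- l) f p.2 p.1 =
  \sum_(a <- undup (unzip2 l)) f a (\sum_(p <- l | p.2 == a) p.1).
Proof.
move=> f0 fD; under [RHS]eq_bigr => a do rewrite (big_morph (f a) (fD a) (f0 a)).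
rewrite (exchange_big_dep predT) //= big_seq [RHS]big_seq; apply: eq_bigr => p pl.
have pm : p.2 \in undup (unzip2 l) by rewrite mem_undup map_f.
under eq_bigl do rewrite eq_sym.
by rewrite -big_filter filter_pred1_uniq ?undup_uniq // big_seq1.
Qed.

Lemma sum_pairs_undup (V : lmodType F) (x : K -> V) (l : seq (F * K)) :
  \sum_(p <- l) p.1 *: x p.2 =
  \sum_(a <- undup (unzip2 l)) (\sum_(p <- l | p.2 == a) p.1) *: x a.
Proof.
apply: (@sum_pairs_merge F V (fun a c => c *: x a)) => [a|a c c']; first exact: scale0r.
exact: scalerDl.
Qed.

Lemma lspan_family (V : lmodType F) (P : K -> Prop) (x : K -> V) v :
  lspan (fun y => exists2 k, P k & y = x k) v ->
  exists (L : seq K) (c : K -> F), [/\ uniq L, forall k, k \in L -> P k /\ c k != 0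
    & v = \sum_(k <- L) c k *: x k].
Proof.
move=> sv.
have [l lP ->] : exists2 l : seq (F * K), (forall p, p \in l -> P p.2)
    & v = \sum_(p <- l) p.1 *: x p.2.
  elim: sv => [|c _ w [k Pk ->] _ [l lP ->]]; first by exists [::]; rewrite ?big_nil.
  exists ((c, k) :: l); last by rewrite big_cons.
  by move=> p; rewrite inE => /orP[/eqP->//|/lP].
rewrite sum_pairs_undup; set c := fun a => \sum_(p <- l | p.2 == a) p.1.
exists [seq a <- undup (unzip2 l) | c a != 0], c; split.
- by rewrite filter_uniq ?undup_uniq.
- move=> k; rewrite mem_filter mem_undup => /andP[ck /mapP[p pl kp]]; split=> //.
  by rewrite kp; apply: lP.
rewrite big_filter [LHS](bigID (fun a => c a != 0)) /= [X in _ + X]big1 ?addr0 // => a.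
by rewrite negbK => /eqP ca; rewrite -/(c a) ca scale0r.
Qed.

Lemma indep_sum_pairs (V W : lmodType F) (x : K -> V) (y : K -> W) (l : seq (F * K)) :
  (forall (s : seq K) (c : K -> F), uniq s -> \sum_(a <- s) c a *: x a = 0 -> forall a, a \in s -> c a = 0) ->
  \sum_(p <- l) p.1 *: x p.2 = 0 -> \sum_(p <- l) p.1 *: y p.2 = 0.
Proof.
move=> ix; rewrite !sum_pairs_undup => /ix h; rewrite big_seq big1 // => a al.
by rewrite h ?undup_uniq ?scale0r.
Qed.

Lemma basis_linear_extension (R : algType F) (u : K -> R) (V : lmodType F) (h : K -> V) :
  is_Fbasis u -> exists f : {linear R -> V}, forall a, f (u a) = h a.
Proof.
move=> [free gen].
have genp r : exists l : seq (F * K), r = \sum_(p <- l) p.1 *: u p.2.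
  have [s [c ->]] := gen r; exists [seq (c a, a) | a <- s].
  by rewrite big_map.
pose l r := proj1_sig (constructive_indefinite_description _ (genp r)).
have lP r : r = \sum_(p <- l r) p.1 *: u p.2.
  exact: (proj2_sig (constructive_indefinite_description _ (genp r))).
pose f r := \sum_(p <- l r) p.1 *: h p.2.
have uniqf r l' : r = \sum_(p <- l') p.1 *: u p.2 -> f r = \sum_(p <- l') p.1 *: h p.2.
  move=> rl; apply/eqP; rewrite -subr_eq0 -sumrN; apply/eqP.
  have neg (W : lmodType F) (y : K -> W) : \sum_(p <- l') - (p.1 *: y p.2) =
      \sum_(p <- [seq (- p.1, p.2) | p <- l']) p.1 *: y p.2.
    by rewrite big_map; apply: eq_bigr => p _; rewrite scaleNr.
  rewrite neg -big_cat; apply: indep_sum_pairs free _.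
  by rewrite big_cat -neg /= sumrN -rl -lP subrr.
have linf : linear f.
  move=> c x y; rewrite (uniqf _ ([seq (c * p.1, p.2) | p <- l x] ++ l y)).
    rewrite big_cat big_map /= /f scaler_sumr; congr (_ + _).
    by apply: eq_bigr => p _; rewrite scalerA.
  rewrite big_cat big_map /= {1}[x]lP {1}[y]lP scaler_sumr; congr (_ + _).
  by apply: eq_bigr => p _; rewrite scalerA.
pose fl : {linear R -> V} := HB.pack f (GRing.isLinear.Build _ _ _ _ f linf).
exists fl => a; rewrite /= (uniqf _ [:: (1, a)]) big_seq1 /= scale1r //.
Qed.

End Families.

Section RightIdeals.
Variables (F : fieldType) (R : algType F).
Implicit Types I : R -> Prop.

Lemma right_ideal_subspace I : right_ideal I -> subspace I.
Proof.
move=> [I0 [ID IM]]; split=> // c x Ix.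
by rewrite -[x]mulr1 scalerAr; apply: IM.
Qed.

Lemma dev_lt_interval k (A B A' B' : R -> Prop) :
  subI B B' -> subI A' A -> dev_lt k B A -> dev_lt k B' A'.
Proof.
case: k => [|k] BB AA; first by move=> AB x /AA/AB/BB.
move=> H c ri cAB; apply: H => // i; have [Bc cA] := cAB i.
by split=> x; [move/BB/Bc|move/cA/AA].
Qed.

End RightIdeals.

Section Twisted.
Variables (F : fieldType) (A : zmodType) (R : algType F) (tau : A -> A -> F) (u : A -> R).
Hypothesis H : is_twisted_group_algebra tau u.

Let tau0 a b : tau a b != 0. Proof. by have [] := H. Qed.
Let ub : is_Fbasis u. Proof. by have [_ []] := H. Qed.

Lemma twM a b : u a * u b = tau a b *: u (a + b).
Proof. by have [_ []] := H. Qed.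

Lemma tw_span r : lspan (fun y => exists2 a, True & y = u a) r.
Proof.
have [_ gen] := ub; have [s [c ->]] := gen r; elim: s => [|a s IH]; rewrite ?big_nil ?big_cons.
  exact: lspan0.
by apply: lspanS => //; exists a.
Qed.

Lemma tw_neq0 a : u a != 0.
Proof.
apply/eqP => ua; have [free _] := ub.
have := free [:: a] (fun=> 1) isT; rewrite big_seq1 scale1r ua => /(_ erefl a (mem_head _ _)).
by move/eqP; rewrite oner_eq0.
Qed.

Lemma tau_0l a : tau 0 a = tau 0 0.
Proof.
have : u 0 * u 0 * u a = u 0 * (u 0 * u a) by rewrite mulrA.
rewrite !twM addr0 add0r -scalerAl -scalerAr !twM add0r !scalerA => /eqP.
rewrite -subr_eq0 -scalerBl scaler_eq0 (negbTE (tw_neq0 a)) orbF subr_eq0.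
by move/eqP/mulIf => ->.
Qed.

Lemma tw_0 : u 0 = tau 0 0 *: 1.
Proof.
have lm r : u 0 * r = tau 0 0 *: r.
  have : lspan (fun y => exists2 a, True & y = u a) r by apply: tw_span.
  elim=> [|c _ y [a _ ->] _ IH]; first by rewrite mulr0 scaler0.
  by rewrite mulrDr IH -scalerAr twM add0r tau_0l scalerDr !scalerA mulrC.
by rewrite -[u 0]mulr1 lm.
Qed.

Lemma tau_0r a : tau a 0 = tau 0 0.
Proof.
have := twM a 0; rewrite tw_0 -scalerAr mulr1 addr0 => /eqP.
rewrite -subr_eq0 -scalerBl scaler_eq0 (negbTE (tw_neq0 a)) orbF subr_eq0.
by move/eqP.
Qed.

Lemma twD a b : u (a + b) = (tau a b)^-1 *: (u a * u b).
Proof. by rewrite twM scalerA mulVf // scale1r. Qed.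

Lemma tw_right_ideal (I : R -> Prop) :
  subspace I -> (forall x a, I x -> I (x * u a)) -> right_ideal I.
Proof.
move=> sI Iu; have [I0 ID IZ] := sI; split=> //; split=> // x r Ix.
have : lspan (fun y => exists2 a, True & y = u a) r by apply: tw_span.
elim=> [|c _ y [a _ ->] _ IH]; first by rewrite mulr0.
by rewrite mulrDr -scalerAr; apply: ID => //; apply/IZ/Iu.
Qed.

(** Monomials are units, with inverse a scalar multiple of [u (- a)]. *)
Lemma twMK x (I : R -> Prop) a : right_ideal I -> I (x * u a) -> I x.
Proof.
move=> rI; have [_ [_ IM]] := rI; move/(IM _ (u (- a))).
rewrite -mulrA twM subrr tw_0 scalerA -scalerAr mulr1.
by apply: subspaceZ; [apply: right_ideal_subspace|rewrite mulf_neq0].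
Qed.

End Twisted.

(** * Coordinates and monoid generators of a free abelian group *)

Section Coords.
Variable A : zmodType.

Definition is_coords n (co : nat -> A -> int) :=
  [/\ forall i a b, co i (a + b) = co i a + co i b,
      forall a, (forall i, (i < n)%N -> co i a = 0) -> a = 0
    & forall z : nat -> int, exists a, forall i, (i < n)%N -> co i a = z i].

Variables (n : nat) (co : nat -> A -> int).
Hypothesis Hco : is_coords n co.

Lemma coD i a b : co i (a + b) = co i a + co i b. Proof. by have [] := Hco. Qed.
Lemma co0 i : co i 0 = 0.
Proof. by apply: (addrI (co i 0)); rewrite -coD !addr0. Qed.
Lemma coN i a : co i (- a) = - co i a.
Proof. by apply: (addrI (co i a)); rewrite -coD !subrr co0. Qed.
Lemma coB i a b : co i (a - b) = co i a - co i b. Proof. by rewrite coD coN. Qed.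
Lemma coMn i a k : co i (a *+ k) = co i a *+ k.
Proof. by elim: k => [|k IH]; rewrite ?mulr0n ?co0 // !mulrS coD IH. Qed.
Lemma coMz i a k : co i (a *~ k) = co i a *~ k.
Proof. by case: k => k; rewrite ?NegzE ?mulrNz ?coN -!pmulrn coMn. Qed.
Lemma co_sum i I (r : seq I) (P : pred I) (f : I -> A) :
  co i (\sum_(j <- r | P j) f j) = \sum_(j <- r | P j) co i (f j).
Proof. exact: (big_morph _ (coD i) (co0 i)). Qed.

Lemma co_inj a b : (forall i, (i < n)%N -> co i a = co i b) -> a = b.
Proof.
have [_ inj _] := Hco; move=> ab; apply/eqP; rewrite -subr_eq0; apply/eqP/inj => i ilt.
by rewrite coB ab // subrr.
Qed.

Lemma coords_basis : exists e : nat -> A,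
  (forall i j, (i < n)%N -> co i (e j) = (i == j)%:R) /\
  forall a, a = \sum_(j < n) e j *~ co j a.
Proof.
have [_ _ surj] := Hco.
have ex j := surj (fun i => (i == j)%:R).
pose e j := proj1_sig (constructive_indefinite_description _ (ex j)).
have eP j : forall i, (i < n)%N -> co i (e j) = (i == j)%:R.
  exact: (proj2_sig (constructive_indefinite_description _ (ex j))).
exists e; split=> [i j|a]; first exact: eP.
apply: co_inj => i ilt; rewrite co_sum (bigD1 (Ordinal ilt)) //= coMz eP // eqxx big1.
  by rewrite addr0 intz.
move=> j ji; rewrite coMz eP //= (_ : (i == j) = false) ?mul0rz //.
by apply/eqP => ij; move/eqP: ji; apply; apply/val_inj.
Qed.

Definition mnm_eval N (d : 'I_N -> A) (s : 'X_{1..N}) := \sum_i d i *+ s i.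

Lemma mnm_evalD N (d : 'I_N -> A) s t :
  mnm_eval d (s + t)%MM = mnm_eval d s + mnm_eval d t.
Proof. by rewrite /mnm_eval -big_split /=; apply: eq_bigr => i _; rewrite mnmDE mulrnDr. Qed.

Lemma mnm_eval0 N (d : 'I_N -> A) : mnm_eval d 0%MM = 0.
Proof. by rewrite /mnm_eval big1 // => i _; rewrite mnm0E. Qed.

(** The family lists a basis and its opposites, which generate the group as a monoid. By pigeonhole,
    more than [n] of these [n + n] elements include an opposite pair. *)
Lemma coords_generators : exists d : 'I_(n + n) -> A,
  (forall a, exists s, a = mnm_eval d s) /\
  forall S : {set 'I_(n + n)}, (n < #|S|)%N ->
    exists i j, [/\ i \in S, j \in S & i != j /\ d i + d j = 0].
Proof.
have [e [_ eP]] := coords_basis.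
exists (fun i => match split i with inl j => e j | inr j => - e j end); split.
  move=> a; exists [multinom (match split i with
    | inl j => if co j a is Posz k then k else 0%N
    | inr j => if co j a is Negz k then k.+1 else 0%N end) | i < n + n]%MM.
  rewrite {1}[a]eP /mnm_eval big_split_ord /= -big_split /=; apply: eq_bigr => j _.
  rewrite !mnmE.
  have -> : split (lshift n j) = inl j by apply: (can_inj unsplitK); rewrite splitK.
  have -> : split (rshift n j) = inr j by apply: (can_inj unsplitK); rewrite splitK.
  case: (co j a) => k; first by rewrite mulr0n addr0 -pmulrn.
  by rewrite mulr0n add0r NegzE mulrNz -pmulrn mulNrn.
move=> S cS.
have [j [jl jr]] : exists j : 'I_n, lshift n j \in S /\ rshift n j \in S.
  apply: NNPP => N; move: cS; rewrite ltnNge => /negP; apply.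
  pose f (i : 'I_(n + n)) := match split i with inl j => j | inr j => j end.
  rewrite -[X in (_ <= X)%N]card_ord -(card_in_imset (f := f)) ?max_card // => i i' iS i'S.
  rewrite /f -[i]splitK -[i']splitK !unsplitK; move: iS i'S.
  rewrite -{1}[i]splitK -{1}[i']splitK.
  case: (split i) => j; case: (split i') => j' /= h h' jj; subst j' => //.
    by case: N; exists j.
  by case: N; exists j.
exists (lshift n j), (rshift n j); split=> //; split; first by rewrite eq_lrshift.
have -> : split (lshift n j) = inl j by apply: (can_inj unsplitK); rewrite splitK.
have -> : split (rshift n j) = inr j by apply: (can_inj unsplitK); rewrite splitK.
by rewrite subrr.
Qed.

End Coords.

Lemma row_coords n : exists co, @is_coords 'rV[int]_n n co.
Proof.
exists (fun i (a : 'rV[int]_n) => if insub i is Some j then a 0 (j : 'I_n) else 0); split.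
- by move=> i a b; case: insub => [j|]; rewrite ?mxE ?addr0.
- move=> a aP; apply/rowP => j; rewrite mxE.
  by have := aP j (ltn_ord j); rewrite valK.
move=> z; exists (\row_j z j) => i ilt; rewrite insubT /= mxE //.
Qed.

Lemma prod_coords (A1 A2 : zmodType) n1 n2 co1 co2 :
  @is_coords A1 n1 co1 -> @is_coords A2 n2 co2 ->
  exists co, @is_coords (A1 * A2)%type (n1 + n2) co.
Proof.
move=> h1 h2.
exists (fun i (a : A1 * A2) => if (i < n1)%N then co1 i a.1 else co2 (i - n1)%N a.2); split.
- by move=> i a b; case: ifP => _; rewrite (coD h1, coD h2).
- move=> [a b] abP; congr (_, _).
    apply: (co_inj h1) => i ilt; have := abP i.
    by rewrite ltn_addr // ilt (co0 h1); apply.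
  apply: (co_inj h2) => i ilt; have := abP (n1 + i)%N.
  by rewrite ltn_add2l -{2}[n1]addn0 ltn_add2l addKn /= (co0 h2); apply.
move=> z; have [_ _ /(_ z)[a aP]] := h1; have [_ _ /(_ (fun i => z (n1 + i)%N))[b bP]] := h2.
exists (a, b) => i ilt; case: ifP => i1 /=; first exact: aP.
rewrite bP; first by rewrite subnKC // leqNgt i1.
by move: ilt i1; lia.
Qed.

(** * Upper bound for the Krull dimension *)

Section Boxes.

Definition mnm_box e r : seq 'X_{1..e} :=
  codom (fun f : {ffun 'I_e -> 'I_r.+1} => [multinom (f i : nat) | i < e]%MM).

Lemma mnm_box_uniq e r : uniq (mnm_box e r).
Proof.
rewrite map_inj_uniq ?enum_uniq // => f g fg; apply/ffunP => i.
by apply/val_inj; have := congr1 (fun m : 'X_{1..e} => m i) fg; rewrite !mnmE.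
Qed.

Lemma size_mnm_box e r : size (mnm_box e r) = (r.+1 ^ e)%N.
Proof. by rewrite size_codom card_ffun !card_ord. Qed.

Lemma mnm_boxP e r k : k \in mnm_box e r -> forall i, (k i <= r)%N.
Proof. by case/codomP => f -> i; rewrite mnmE -ltnS. Qed.

Variables (A : zmodType) (N : nat) (d : 'I_N -> A).
Hypothesis dgen : forall a, exists s, a = mnm_eval d s.

Lemma mnm_eval_lift e (c : 'I_e -> A) : exists C, forall r (k : 'X_{1..e}),
  (forall i, k i <= r)%N -> exists w, mnm_eval c k = mnm_eval d w /\ (mdeg w <= C * r)%N.
Proof.
have ex i := dgen (c i).
pose t i := proj1_sig (constructive_indefinite_description _ (ex i)).
have tP i : c i = mnm_eval d (t i).
  exact: (proj2_sig (constructive_indefinite_description _ (ex i))).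
have evM s k : mnm_eval d (s *+ k)%MM = mnm_eval d s *+ k.
  by elim: k => [|k IH]; rewrite ?mulm0n ?mnm_eval0 // mulmS mnm_evalD IH mulrS.
exists (\sum_i mdeg (t i))%N => r k kr; exists (\sum_i t i *+ k i)%MM; split.
  rewrite (big_morph (mnm_eval d) (mnm_evalD d) (mnm_eval0 d)).
  by apply: eq_bigr => i _; rewrite evM tP.
rewrite mdeg_sum big_distrl /=; apply: leq_sum => i _.
by rewrite mdegMn leq_mul.
Qed.

End Boxes.

Section Upper.
Variables (F : fieldType) (A : zmodType) (T : algType F) (tau : A -> A -> F) (u : A -> T).
Hypothesis H : is_twisted_group_algebra tau u.
Variables (N : nat) (d : 'I_N -> A).
Hypothesis dgen : forall a, exists s, a = mnm_eval d s.

Let mon (s : 'X_{1..N}) := u (mnm_eval d s).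
Implicit Types (s t w : 'X_{1..N}) (I J : T -> Prop).

Let monM s t : mon s * mon t = tau (mnm_eval d s) (mnm_eval d t) *: mon (s + t)%MM.
Proof. by rewrite /mon (twM H) -mnm_evalD. Qed.

Let tau0 a b : tau a b != 0. Proof. by have [] := H. Qed.

Definition mspan (P : 'X_{1..N} -> Prop) := lspan (fun y => exists2 w, P w & y = mon w).
Definition low s := mspan (fun w => (w < s)%O).

(* Distinct exponents may denote the same monomial ([d] will list a basis of [A] and
   its opposites), so an exponent can be leading already for the zero ideal. *)
Definition lmon I s := exists2 a, I a & low s (a - mon s).

Lemma mspan_mon (P : 'X_{1..N} -> Prop) w : P w -> mspan P (mon w).
Proof. by move=> Pw; apply: lspan_gen; exists w. Qed.

Lemma low_mul s t y : low s y -> low (s + t)%MM (y * mon t).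
Proof.
elim=> [|c _ z [w ws ->] _ IH]; first by rewrite mul0r; apply: lspan0.
rewrite mulrDl -scalerAl monM scalerA; apply: lspanD => //; apply/lspanZ/mspan_mon.
by rewrite ltmc_add2l.
Qed.

Lemma lmon_upset I : right_ideal I -> upset (lmon I).
Proof.
move=> rI s t [a Ia la]; set c := tau (mnm_eval d s) (mnm_eval d t).
have [_ [_ IM]] := rI; have [_ _ IZ] := right_ideal_subspace rI.
exists (c^-1 *: (a * mon t)); first exact/IZ/IM.
have := low_mul t la; rewrite mulrBl monM -/c => /(lspanZ c^-1).
by rewrite scalerBr scalerA mulVf ?tau0 ?scale1r.
Qed.

Lemma lmon_sub I J : subI I J -> forall s, lmon I s -> lmon J s.
Proof. by move=> IJ s [a /IJ Ja la]; exists a. Qed.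

(** The coefficient [c] may vanish, since top terms can cancel; [reduce] then continues below
    [w]. *)
Lemma mspan_top (P : 'X_{1..N} -> Prop) y : mspan P y ->
  y = 0 \/ exists w c, P w /\ low w (y - c *: mon w).
Proof.
elim=> [|c _ z [w Pw ->] _ IH]; [by left|right].
case: IH => [->|[w' [c' [Pw' lz]]]].
  by exists w, c; rewrite addr0 subrr; split=> //; apply: lspan0.
case: (ltgtP w w') => [lt|lt|e].
- exists w', c'; split=> //; rewrite -addrA; apply: lspanS => //; by exists w.
- exists w, c; split=> //; rewrite addrC addKr -[z](subrK (c' *: mon w')).
  apply: lspanD; last by apply/lspanZ/mspan_mon.
  by apply: lspan_sub lz => _ [v vw ->]; apply: mspan_mon; apply: lt_trans lt.
- exists w, (c + c'); split=> //; subst w'.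
  by rewrite scalerDl opprD addrACA subrr add0r.
Qed.

Lemma mspan_total y : exists C, mspan (fun w => (mdeg w <= C)%N) y.
Proof.
elim: (tw_span H y) => [|c _ z [a _ ->] _ [C IH]]; first by exists 0%N; apply: lspan0.
have [s ->] := dgen a; exists (maxn C (mdeg s)); apply: lspanS.
  by exists s => //; rewrite leq_maxr.
by apply: lspan_sub IH => _ [w wC ->]; apply: mspan_mon; rewrite (leq_trans wC) ?leq_maxl.
Qed.

Section Interval.
Variables I J : T -> Prop.
Hypotheses (rI : right_ideal I) (rJ : right_ideal J) (JI : subI J I).

Let wit s := epsilon (inhabits 0) (fun a => I a /\ low s (a - mon s)).

(** Leading-term reduction. A top monomial in [lmon J] is removed by an element of [J], any other
    one by the witness [wit s]; the monomial order is well founded, and [P] passes to smaller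
    exponents. *)
Lemma reduce (P : 'X_{1..N} -> Prop) y :
  (forall w w', (w' < w)%O -> P w -> P w') -> I y -> mspan P y ->
  lspan (fun z => J z \/ exists s l, [/\ diff (lmon I) (lmon J) s, P s, (l < 1)%N & z = wit s]) y.
Proof.
move=> Pd; have sI := right_ideal_subspace rI; have [_ ID IZ] := sI.
have aux s : forall c z, P s -> I z -> low s (z - c *: mon s) ->
    lspan (fun z => J z \/ exists s l, [/\ diff (lmon I) (lmon J) s, P s, (l < 1)%N & z = wit s]) z.
  elim/(ltmwf (n := N)): s => s IH c z Ps Iz lz.
  have fin z' : I z' -> low s z' -> lspan (fun z => J z \/ exists s l,
      [/\ diff (lmon I) (lmon J) s, P s, (l < 1)%N & z = wit s]) z'.
    move=> Iz' /mspan_top[->|[w [c' [ws lz']]]]; first exact: lspan0.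
    by apply: (IH w ws c') => //; apply: Pd Ps.
  case: (eqVneq c 0) => [c0|c0]; first by apply: fin => //; move: lz; rewrite c0 scale0r subr0.
  have Is : lmon I s.
    exists (c^-1 *: z); first exact: IZ.
    by have := lspanZ c^-1 lz; rewrite scalerBr scalerA mulVf // scale1r.
  suff [x [Ix lx sx]] : exists x, [/\ I x, low s (x - mon s) & lspan (fun z => J z \/
      exists s l, [/\ diff (lmon I) (lmon J) s, P s, (l < 1)%N & z = wit s]) x].
    rewrite -[z](subrK (c *: x)); apply: lspanD; last exact: lspanZ.
    apply: fin; first by apply: subspaceB => //; apply: IZ.
    have -> : z - c *: x = (z - c *: mon s) - c *: (x - mon s).
      by rewrite scalerBr opprB addrA subrK.
    by apply: subspaceB => //; [apply: lspan_subspace|apply: lspanZ].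
  case: (classic (lmon J s)) => [[x Jx lx]|nJ].
    by exists x; split=> //; [apply: JI|apply: lspan_gen; left].
  have [a Ia la] := Is.
  have := @epsilon_spec T (inhabits 0) (fun a => I a /\ low s (a - mon s)) (ex_intro _ a (conj Ia la)).
  rewrite -/(wit s) => -[Iw lw]; exists (wit s); split=> //.
  by apply: lspan_gen; right; exists s, 0%N.
by move=> Iy /mspan_top[->|[w [c [Pw lw]]]]; [apply: lspan0|apply: aux lw].
Qed.

(** Multiplying [v] by a box of monomials of side [r] raises degrees only linearly in [r], so
    reduction and [cone_of_growth] turn freeness in the module into a cone of leading exponents. *)
Lemma cone_of_free e (c : 'I_e -> A) v : I v ->
  indep J (fun k : 'X_{1..e} => v * u (mnm_eval c k)) ->
  has_cone_dim (diff (lmon I) (lmon J)) e.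
Proof.
move=> Iv ind; have [C0 vC] := mspan_total v; have [C1 C1P] := mnm_eval_lift dgen c.
apply: (@cone_of_growth F T N _ _ e J _ (fun k => v * u (mnm_eval c k))
  (mnm_box e) (fun s _ => wit s) (C0 + C1)%N 1) => //.
- exact: lmon_upset.
- exact: lmon_upset.
- exact: right_ideal_subspace.
- by move=> r; split; [apply: mnm_box_uniq|apply: size_mnm_box].
move=> r k /mnm_boxP/C1P[t [-> tC]].
have dw (w w' : 'X_{1..N}) : (w' < w)%O ->
    (mdeg w <= (C0 + C1) * r.+1 -> mdeg w' <= (C0 + C1) * r.+1)%N.
  by move=> /ltW/lemc_mdeg/leq_trans; apply.
have [_ [_ IM]] := rI.
apply: lspan_sub (reduce dw (IM _ _ Iv) _).
  move=> y [Jy|[s [l [Ds ms l1 ->]]]]; apply: lspan_gen; first by left.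
  by right; exists s, l.
elim: vC => [|b _ y [w wC ->] _ IH]; first by rewrite mul0r; apply: lspan0.
rewrite mulrDl -scalerAl -/(mon t) monM scalerA; apply: lspanD => //.
by apply/lspanZ/mspan_mon; rewrite mdegD; move: wC tC; nia.
Qed.

End Interval.

Variables (n e0 : nat).
Hypothesis dpair : forall S : {set 'I_N}, (n < #|S|)%N ->
    exists i j, [/\ i \in S, j \in S & i != j /\ d i + d j = 0].
Hypothesis Hfree : forall J v, right_ideal J -> ~ J v ->
  exists r (c : 'I_e0 -> A), indep J (fun k : 'X_{1..e0} => v * r * u (mnm_eval c k)).

(** A nonzero factor already carries a cone of dimension [e0] by [Hfree]; each further level of
    deviation costs one more cone direction by [cone_dim_chain]. *)
Lemma dev_lt_of_cone k : forall I J, right_ideal I -> right_ideal J -> subI J I ->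
  ~ has_cone_dim (diff (lmon I) (lmon J)) (e0 + k) -> dev_lt k J I.
Proof.
elim: k => [|k IH] I J rI rJ JI; rewrite ?addn0 ?addnS => nc /=.
  move=> x Ix; apply: NNPP => Jx; apply: nc; have [r [c ind]] := Hfree rJ Jx.
  have [_ [_ IM]] := rI.
  by apply: (cone_of_free rI rJ JI (IM _ r Ix) ind).
move=> c rc cIJ cdec.
have [M MP] : exists M, forall i, (M <= i)%N ->
    ~ has_cone_dim (diff (lmon (c i)) (lmon (c i.+1))) (e0 + k).
  apply: (cone_dim_chain (U := lmon I) (V := lmon J) (c := fun i => lmon (c i))) => //.
  - exact: lmon_upset.
  - exact: lmon_upset.
  - by move=> i; apply: lmon_sub; have [] := cIJ i.
  - by move=> i; apply: lmon_sub; have [] := cIJ i.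
  - by move=> i; apply: lmon_sub.
by exists M => i Mi; apply: IH => //; apply: MP.
Qed.

(** A cone with more than [n] directions contains two opposite generators, and moving along both
    does not change the monomial. That exponent is then leading for the zero ideal and cannot lie in
    the difference. *)
Lemma kdim_le_of_free : kdim_le T (n - e0).
Proof.
have r0 : right_ideal (fun x : T => x = 0).
  by split=> //; split=> [x y -> ->|x r ->]; rewrite ?addr0 ?mul0r.
apply: dev_lt_of_cone => //.
move=> [S [v [cS cone]]].
have [i [j [iS jS [ij dij]]]] : exists i j, [/\ i \in S, j \in S & i != j /\ d i + d j = 0].
  by apply: dpair; rewrite cS; lia.
have supp k : k \notin S -> (U_(i) + U_(j))%MM k = 0%N.
  move=> kS; rewrite mnmDE !mnm1E; case: eqP => [e|_]; first by rewrite -e iS in kS.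
  by case: eqP => // e; rewrite -e jS in kS.
have [_ []] := cone _ supp.
exists 0 => //; rewrite sub0r -scaleN1r.
(* The two exponents denote the same group element, but [v] has smaller degree, so the monomial lies
   below itself and [0] witnesses the leading exponent. *)
have -> : mon (v + (U_(i) + U_(j)))%MM = mon v.
  rewrite /mon !mnm_evalD; have ev1 l : mnm_eval d U_(l)%MM = d l.
    by rewrite /mnm_eval (bigD1 l) //= mnm1E eqxx big1 ?addr0 // => l' l'l;
       rewrite mnm1E eq_sym (negbTE l'l).
  by rewrite !ev1 dij addr0.
apply/lspanZ/mspan_mon; apply: lt_mdeg_ltmc; rewrite !mdegD !mdeg1; lia.
Qed.

End Upper.

(** * Lower bound for the Krull dimension *)

Section IntBinomial.
Variable F : fieldType.

(** The generalized binomial coefficient; [Negz m] is [-(m + 1)], for which it equals [(-1)^v] times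
    [m + v] choose [v]. *)
Definition zbin (k : int) (v : nat) : F :=
  match k with
  | Posz m => 'C(m, v)%:R
  | Negz m => (-1) ^+ v * 'C(m + v, v)%:R
  end.

Lemma zbin_0 k : zbin k 0 = 1.
Proof. by case: k => k /=; rewrite ?addn0 bin0 ?expr0 ?mulr1. Qed.

Lemma zbinS k v : zbin (k + 1) v.+1 = zbin k v.+1 + zbin k v.
Proof.
case: k => [k|[|k]].
- by rewrite (_ : Posz k + 1 = k.+1) /= ?binS ?natrD //; lia.
- rewrite (_ : Negz 0 + 1 = 0) //= !add0n !binn exprS bin_small //; ring.
rewrite (_ : Negz k.+1 + 1 = Negz k) /=; last by lia.
have -> : 'C(k.+1 + v.+1, v.+1) = ('C(k + v.+1, v.+1) + 'C(k.+1 + v, v))%N.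
  by rewrite addSn binS addSnnS.
rewrite natrD exprS; ring.
Qed.

Definition mbin j (k : nat -> int) (v : nat -> nat) : F := \prod_(i < j) zbin (k i) (v i).

Definition decr (v : nat -> nat) l i := if i == l then (v i).-1 else v i.

Lemma eq_mbin j k k' v v' : (forall i, (i < j)%N -> k i = k' i /\ v i = v' i) ->
  mbin j k v = mbin j k' v'.
Proof. by move=> h; apply: eq_bigr => i _; have [-> ->] := h i (ltn_ord i). Qed.

Lemma mbin_shift j k v l : (l < j)%N ->
  mbin j (fun i => k i + (i == l)%:R) v =
  mbin j k v + (if v l == 0%N then 0 else mbin j k (decr v l)).
Proof.
move=> lj; rewrite /mbin (bigD1 (Ordinal lj)) //= eqxx.
have -> : \prod_(i < j | i != Ordinal lj) zbin (k i + (i == l :> nat)%:R) (v i) =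
          \prod_(i < j | i != Ordinal lj) zbin (k i) (v i).
  by apply: eq_bigr => i il; rewrite (_ : (i == l :> nat) = false) ?addr0 //;
     apply/negbTE; apply: contra il => /eqP e; apply/eqP/val_inj.
rewrite [X in _ = X + _](bigD1 (Ordinal lj)) //=.
have -> : (if v l == 0%N then 0 else \prod_(i < j) zbin (k i) (decr v l i)) =
   (if v l == 0%N then 0 else zbin (k l) (v l).-1) *
   \prod_(i < j | i != Ordinal lj) zbin (k i) (v i).
  case: ifP => _; first by rewrite mul0r.
  rewrite (bigD1 (Ordinal lj)) //= /decr eqxx; congr (_ * _).
  by apply: eq_bigr => i il; rewrite (_ : (i == l :> nat) = false) //;
     apply/negbTE; apply: contra il => /eqP e; apply/eqP/val_inj.
rewrite -mulrDl; congr (_ * _).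
by case: (v l) => [|m] /=; rewrite ?zbin_0 ?addr0 // zbinS.
Qed.

End IntBinomial.

(** * Deviation of the lattice of up-sets *)

Section PosetDeviation.
Variable j : nat.
Implicit Types (U V : (nat -> nat) -> Prop) (v w : nat -> nat).

Definition upfun U := forall v w, (forall i, (i < j)%N -> (v i <= w i)%N) -> U v -> U w.

Fixpoint updev k V U : Prop :=
  match k with
  | 0 => forall v, U v -> V v
  | k'.+1 => forall c : nat -> ((nat -> nat) -> Prop),
      (forall i, upfun (c i)) ->
      (forall i v, (V v -> c i v) /\ (c i v -> U v)) ->
      (forall i v, c i.+1 v -> c i v) ->
      exists N, forall i, (N <= i)%N -> updev k' (c i.+1) (c i)
  end.

(** Cutting by the conditions [n <= v l] gives an infinite chain, each factor of which contains a
    slice [v l = N], a face of one dimension less. *)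
Lemma updev_face l : (l <= j)%N -> forall V U v0, upfun V -> upfun U ->
  (forall v, V v -> U v) ->
  (forall v, (forall i, (l <= i < j)%N -> v i = v0 i) -> U v /\ ~ V v) ->
  ~ updev l V U.
Proof.
elim: l => [|l IH] lj V U v0 upV upU VU face /=.
  by move=> UV; have [Uv []] := face v0 (fun _ _ => erefl); apply: UV.
pose c n v := V v \/ (U v /\ n <= v l)%N.
have upc n : upfun (c n).
  move=> v w vw [Vv|[Uv nv]]; first by left; apply: upV vw Vv.
  by right; split; [apply: upU vw Uv|apply: leq_trans nv (vw _ lj)].
have cdec n v : c n.+1 v -> c n v.
  by move=> [|[Uv nv]]; [left|right; split=> //; apply: ltnW].
move=> /(_ c)[].
- exact: upc.
- by move=> n v; split; [left|move=> [/VU|[]]].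
- exact: cdec.
move=> N /(_ N (leqnn N)).
apply: (IH (ltnW lj) _ _ (fun i => if i == l then N else v0 i)).
- exact: upc.
- exact: upc.
- exact: cdec.
move=> v vP; have vl : v l = N by rewrite vP ?eqxx // leqnn.
have [Uv Vv] : U v /\ ~ V v.
  apply: face => i /andP[li ij]; rewrite vP ?(ltnW li) // ifN //.
  by apply: contraTneq li => ->; rewrite ltnn.
split; first by right; rewrite vl.
by move=> [//|[_]]; rewrite vl ltnn.
Qed.

End PosetDeviation.

Section Lower.
Variables (F : fieldType) (A : zmodType) (R : algType F) (tau : A -> A -> F) (u : A -> R).
Hypothesis H : is_twisted_group_algebra tau u.
Variables (n : nat) (co : nat -> A -> int).
Hypothesis Hco : is_coords n co.

Definition in_kernel j a := forall i, (i < j)%N -> co i a = 0.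

Definition fin_over I (ms : seq R) j := forall r,
  lspan (fun y => I y \/ exists m a, [/\ m \in ms, in_kernel j a & y = m * u a]) r.

Variables (I : R -> Prop) (ms : seq R) (j : nat).
Hypotheses (rI : right_ideal I) (I1 : ~ I 1) (Hms : fin_over I ms j) (jn : (j <= n)%N).

Let tau0 a b : tau a b != 0. Proof. by have [] := H. Qed.
Let s := size ms.
Let sI : subspace I. Proof. exact: right_ideal_subspace. Qed.
Implicit Types (U V : (nat -> nat) -> Prop) (v w : nat -> nat) (r : nat -> R).

(** [D v] reads off the coefficient of [t^v] in the map sending [u a] to [(1 + t)^(co a) u a].
    Binomials in place of iterated derivations make this work in every characteristic. *)
Lemma divided_derivation v : exists f : {linear R -> R},
  forall a, f (u a) = mbin F j (co^~ a) v *: u a.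
Proof. by have [_ [ub _]] := H; apply: basis_linear_extension. Qed.

Let D v : {linear R -> R} :=
  proj1_sig (constructive_indefinite_description _ (divided_derivation v)).
Let DP v a : D v (u a) = mbin F j (co^~ a) v *: u a.
Proof. exact: (proj2_sig (constructive_indefinite_description _ (divided_derivation v))). Qed.

Let Dker v x a : in_kernel j a -> D v (x * u a) = D v x * u a.
Proof.
move=> ka; elim: (tw_span H x) => [|c _ y [b _ ->] _ IH].
  by rewrite mul0r linear0 mul0r.
rewrite mulrDl -scalerAl (twM H) scalerA !linearP /= IH !DP mulrDl; congr (_ + _).
rewrite -!scalerAl (twM H) !scalerA; congr (_ *: _).
rewrite (@eq_mbin F j _ (co^~ b) v v); first by ring.
by move=> i ij; rewrite (coD Hco) ka // addr0.
Qed.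

(** On power series, right multiplication by [u t] involves multiplication by [1 + t_l]; this is its
    effect on coefficients. *)
Let Dgen v x t l : (l < j)%N -> (forall i, (i < j)%N -> co i t = (i == l)%:R) ->
  D v (x * u t) = D v x * u t + (if v l == 0%N then 0 else D (decr v l) x * u t).
Proof.
move=> lj tl; elim: (tw_span H x) => [|c _ y [b _ ->] _ IH].
  by rewrite mul0r !linear0 !mul0r; case: ifP; rewrite addr0.
rewrite mulrDl -scalerAl (twM H) scalerA !linearP /= IH !DP.
rewrite (@eq_mbin F j (co^~ (b + t)) (fun i => co i b + (i == l)%:R) v v); last first.
  by move=> i ij; rewrite (coD Hco) tl.
rewrite mbin_shift //; case: ifP => _; rewrite ?addr0.
  by rewrite mulrDl -!scalerAl (twM H) !scalerA; congr (_ *: _ + _); ring.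
rewrite !mulrDl addrACA; congr (_ + _).
by rewrite -!scalerAl (twM H) !scalerA -scalerDl; congr (_ *: _); ring.
Qed.

(* The tuple [r] stands for the element [sum_i ms_i (x) r_i] of the module induced
   from [R / I], seen as a power series in [j] variables with coefficients in
   [R / I]; [theta v r] is its coefficient of exponent [v]. *)
Let theta v r := \sum_(i < s) ms`_i * D v (r i).
Let rmul r a i := r i * u a.
Let Y U r := forall v, ~ U v -> I (theta v r).

Let thetaD v r r' : theta v (fun i => r i + r' i) = theta v r + theta v r'.
Proof. by rewrite -big_split; apply: eq_bigr => i _; rewrite linearD mulrDr. Qed.

Let thetaZ v c r : theta v (fun i => c *: r i) = c *: theta v r.
Proof. by rewrite scaler_sumr; apply: eq_bigr => i _; rewrite linearZ -scalerAr. Qed.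

Let theta_ker v r a : in_kernel j a -> theta v (rmul r a) = theta v r * u a.
Proof. by move=> ka; rewrite mulr_suml; apply: eq_bigr => i _; rewrite Dker // mulrA. Qed.

Let theta_gen v r t l : (l < j)%N -> (forall i, (i < j)%N -> co i t = (i == l)%:R) ->
  theta v (rmul r t) = theta v r * u t +
    (if v l == 0%N then 0 else theta (decr v l) r * u t).
Proof.
move=> lj tl; rewrite /theta; under eq_bigr do rewrite (Dgen _ _ lj tl) mulrDr.
rewrite big_split /= mulr_suml; congr (_ + _); first by apply: eq_bigr => i _; rewrite mulrA.
case: ifP => _; first by rewrite big1 // => i _; rewrite mulr0.
by rewrite mulr_suml; apply: eq_bigr => i _; rewrite mulrA.
Qed.

Let eq_theta v r r' : r =1 r' -> theta v r = theta v r'.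
Proof. by move=> e; apply: eq_bigr => i _; rewrite e. Qed.

Let IMu x a : I x -> I (x * u a). Proof. by have [_ [_ IM]] := rI; apply: IM. Qed.

Let decr_le v l i : (decr v l i <= v i)%N.
Proof. by rewrite /decr; case: ifP => _ //; apply: leq_pred. Qed.

Let stable U a := forall r, Y U r -> Y U (rmul r a).

Let stableD U a b : stable U a -> stable U b -> stable U (a + b).
Proof.
move=> sa sb r Yr v Uv; have [_ _ IZ] := sI.
rewrite (@eq_theta _ _ (fun i => (tau a b)^-1 *: rmul (rmul r a) b i)); last first.
  by move=> i; rewrite /rmul (twD H) -scalerAr mulrA.
by rewrite thetaZ; apply: IZ; apply: (sb _ (sa _ Yr)).
Qed.

Let stable_ker U a : in_kernel j a -> stable U a.
Proof. by move=> ka r Yr v Uv; rewrite theta_ker //; apply/IMu/Yr. Qed.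

(** Multiplication by [1 + t_l] only raises exponents, so it preserves supports in an up-set. For
    the inverse, the coefficients are controlled one after another by induction on the exponent
    [v l]. *)
Let stable_gen U t l : upfun j U -> (l < j)%N ->
  (forall i, (i < j)%N -> co i t = (i == l)%:R) -> stable U t /\ stable U (- t).
Proof.
move=> upU lj tl; have [I0 ID IZ] := sI.
have dU v : ~ U v -> ~ U (decr v l).
  by move=> Uv Ud; apply: Uv; apply: upU Ud => i _; apply: decr_le.
split=> r Yr v Uv.
  rewrite (theta_gen _ _ lj tl); apply: ID; first exact/IMu/Yr.
  by case: ifP => _ //; apply/IMu/Yr/dU.
move: {2}(v l) (leqnn (v l)) => m; elim: m v Uv => [|m IH] v Uv vm.
all: apply: (@twMK _ _ _ _ _ H _ _ t rI).
all: set c := tau (- t) t * tau 0 0.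
all: have E : theta v (rmul (rmul r (- t)) t) = c *: theta v r.
1,3: rewrite -thetaZ; apply: eq_theta => i; rewrite /rmul -mulrA (twM H) addNr (tw_0 H).
1,2: by rewrite scalerA -scalerAr mulr1.
all: have Ic : I (c *: theta v r) by apply/IZ/Yr.
all: rewrite (theta_gen _ _ lj tl) in E.
  by move: vm E; rewrite leqn0 => /eqP->; rewrite eqxx addr0 => ->.
case: (eqVneq (v l) 0%N) E => [_|v0 E]; first by rewrite addr0 => ->.
have -> : theta v (rmul r (- t)) * u t = c *: theta v r - theta (decr v l) (rmul r (- t)) * u t.
  by rewrite -E addrK.
apply: subspaceB => //; apply/IMu/IH; first exact: dU.
by rewrite /decr eqxx; case: (v l) v0 vm.
Qed.

Let stable_all U a : upfun j U -> stable U a.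
Proof.
move=> upU; have [e [eP _]] := coords_basis Hco.
have st0 : stable U 0 by apply: stable_ker => i _; rewrite (co0 Hco).
have st_nat b k : stable U b -> stable U (b *+ k).
  by move=> sb; elim: k => [|k IH]; rewrite ?mulr0n // mulrS; apply: stableD.
rewrite -[a](subrK (\sum_(l < j) e l *~ co l a)); apply: stableD.
  apply: stable_ker => i ij; rewrite (coB Hco) (co_sum Hco) (bigD1 (Ordinal ij)) //=.
  rewrite (coMz Hco) eP ?(leq_trans ij) // eqxx intz big1 ?addr0 ?subrr // => l li.
  rewrite (coMz Hco) eP ?(leq_trans ij) // (_ : (i == l) = false) ?mul0rz //.
  by apply/eqP => il; move/eqP: li; apply; apply/val_inj.
apply: big_ind => // [x y|l _]; first exact: stableD.
have [sp sn] : stable U (e l) /\ stable U (- e l).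
  by apply: (stable_gen upU (ltn_ord l)) => i ij; rewrite eP // (leq_trans ij).
case: (co l a) => k; first by rewrite -pmulrn; apply: st_nat.
by rewrite NegzE mulrNz -pmulrn -mulNrn; apply: st_nat.
Qed.

(** The set [Y U] consists of the tuples whose series is supported in [U] modulo [I]. Filtering
    tuples by their last possibly nonzero index turns this submodule into right ideals [J i U] of
    [R] itself, one for each [i < s]. *)
Let J i U x := exists r, [/\ Y U r, r i = x & forall l, (i < l)%N -> r l = 0].

Let J_right_ideal i U : upfun j U -> right_ideal (J i U).
Proof.
move=> upU; have [I0 ID IZ] := sI; apply: (tw_right_ideal H); first split.
- exists (fun _ => 0); split=> // v _.
  by rewrite /theta big1 // => l _; rewrite linear0 mulr0.
- move=> x y [r [Yr <- r0]] [r' [Yr' <- r'0]]; exists (fun i => r i + r' i); split=> //.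
    by move=> v Uv; rewrite thetaD; apply: ID; [apply: Yr|apply: Yr'].
  by move=> l il; rewrite r0 // r'0 // addr0.
- move=> c x [r [Yr <- r0]]; exists (fun i => c *: r i); split=> //.
    by move=> v Uv; rewrite thetaZ; apply/IZ/Yr.
  by move=> l il; rewrite r0 // scaler0.
move=> x a [r [Yr <- r0]]; exists (rmul r a); split=> //; first exact: stable_all.
by move=> l il; rewrite /rmul r0 // mul0r.
Qed.

Let J_sub i U V : (forall v, V v -> U v) -> subI (J i V) (J i U).
Proof. by move=> VU x [r [Yr rx r0]]; exists r; split=> // v Uv; apply: Yr => /VU. Qed.

(** As for submodules of a filtered module, comparing the graded pieces suffices: the last entry is
    corrected by an element of [Y V], and the index decreases. *)
Let Y_sub U V : (forall v, V v -> U v) -> (forall i, (i < s)%N -> subI (J i U) (J i V)) ->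
  forall r, Y U r -> Y V r.
Proof.
move=> VU JUV r Yr; have [I0 ID IZ] := sI.
have aux p : (p <= s)%N -> forall r, (forall l, (p <= l)%N -> r l = 0) -> Y U r -> Y V r.
  elim: p => [|p IH] ps r' r'0 Yr'.
    by move=> v _; rewrite /theta big1 // => l _; rewrite r'0 // linear0 mulr0.
  have [r2 [Yr2 r2p r20]] : J p V (r' p) by apply: JUV => //; exists r'.
  have Yd : Y V (fun i => r' i + (-1) *: r2 i).
    apply: IH; first exact: ltnW.
      move=> l; rewrite leq_eqVlt => /orP[/eqP<-|pl]; first by rewrite r2p scaleN1r subrr.
      by rewrite r'0 // r20 // scaler0 addr0.
    move=> v Uv; rewrite thetaD thetaZ; apply: ID; first exact: Yr'.
    by apply/IZ/Yr2 => /VU.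
  move=> v Vv; have := ID _ _ (Yd v Vv) (Yr2 v Vv).
  by rewrite thetaD thetaZ scaleN1r subrK.
have E v : theta v r = theta v (fun l => if (l < s)%N then r l else 0).
  by apply: eq_bigr => l _; rewrite ltn_ord.
have := aux s (leqnn s) (fun l => if (l < s)%N then r l else 0).
move=> aux' v Vv; rewrite E; apply: aux' => // [l sl|w Uw].
  by rewrite ltnNge sl.
by rewrite -E; apply: Yr.
Qed.

(** The series [(1 + t)^k] with coefficients in [F] times [1] is attained: expand [u (- a)] over the
    generators with coefficients in the kernel subalgebra, then multiply these by [u a], where [a]
    has coordinates [k]. *)
Let binomial_tuple k : exists r, forall w, I (theta w r - mbin F j k w *: 1).
Proof.
have [e [eP _]] := coords_basis Hco; have [I0 ID IZ] := sI.
pose a := \sum_(l < j) e l *~ k l.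
have ak i : (i < j)%N -> co i a = k i.
  move=> ij; rewrite (co_sum Hco) (bigD1 (Ordinal ij)) //=.
  rewrite (coMz Hco) eP ?(leq_trans ij) // eqxx intz big1 ?addr0 ?subrr // => l li.
  rewrite (coMz Hco) eP ?(leq_trans ij) // (_ : (i == l) = false) ?mul0rz //.
  by apply/eqP => il; move/eqP: li; apply; apply/val_inj.
have [b [bC bI]] : exists b : nat -> R,
    (forall i, lspan (fun y => exists2 c, in_kernel j c & y = u c) (b i)) /\
    I (u (- a) - \sum_(i < s) ms`_i * b i).
  elim: (Hms (u (- a))) => [|c x y Xx _ [b [bC bI]]].
    exists (fun _ => 0); split=> [i|]; first exact: lspan0.
    by rewrite big1 ?subr0 // => i _; rewrite mulr0.
  case: Xx => [Ix|[m [g [mms kg ->]]]].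
    exists b; split=> //; rewrite -addrA; apply: ID => //; exact: IZ.
  exists (fun i => (if i == index m ms then c *: u g else 0) + b i); split=> [i|].
    apply: lspanD => //; case: ifP => _; last exact: lspan0.
    by apply/lspanZ/lspan_gen; exists g.
  under eq_bigr do rewrite mulrDr.
  have lt : (index m ms < s)%N by rewrite index_mem.
  rewrite big_split /= (bigD1 (Ordinal lt)) //= eqxx nth_index // big1 ?addr0.
    by rewrite -scalerAr opprD addrACA subrr add0r.
  move=> i il; rewrite (_ : (i == index m ms :> nat) = false) ?mulr0 //.
  by apply/negbTE; apply: contra il => /eqP e'; apply/eqP/val_inj.
pose c := tau (- a) a * tau 0 0.
exists (fun i => c^-1 *: rmul b a i) => w.
have -> : theta w (fun i => c^-1 *: rmul b a i) =
    (c^-1 * mbin F j k w) *: ((\sum_(i < s) ms`_i * b i) * u a).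
  rewrite thetaZ -scalerA; congr (_ *: _).
  rewrite mulr_suml scaler_sumr; apply: eq_bigr => i _.
  rewrite -mulrA scalerAr; congr (_ * _); rewrite /rmul.
  elim: (bC i) => [|q _ y [g kg ->] _ IH]; first by rewrite mul0r linear0 scaler0.
  rewrite mulrDl -scalerAl (twM H) scalerA linearP /= IH DP scalerDr; congr (_ + _).
  rewrite !scalerA (@eq_mbin F j (co^~ (g + a)) k w w); first by congr (_ *: _); ring.
  by move=> l lj; rewrite (coD Hco) kg // add0r ak.
have c0 : c != 0 by rewrite mulf_neq0.
have -> : mbin F j k w *: (1 : R) = (c^-1 * mbin F j k w) *: (u (- a) * u a).
  by rewrite (twM H) addNr (tw_0 H) !scalerA; congr (_ *: _);
     rewrite -mulrA -/c mulrAC mulVf ?mul1r.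
rewrite -scalerBr -mulrBl; apply/IZ/IMu.
by rewrite -opprB; apply: subspaceN.
Qed.

(** The coefficient of [t^w] in [t^v (1 + t)^k]. The recursion [cfS] writes a factor [t_l] as
    [(1 + t_l) - 1], which reaches every monomial from the binomial series. *)
Let cf v k w : F :=
  if [forall i : 'I_j, v i <= w i]%N then mbin F j k (fun i => w i - v i)%N else 0.

Let cfS v k w l : (l < j)%N ->
  cf (fun i => v i + (i == l))%N k w = cf v (fun i => k i + (i == l)%:R) w - cf v k w.
Proof.
move=> lj; rewrite /cf.
case: (boolP [forall i : 'I_j, v i <= w i]%N) => [/forallP vw|nvw]; last first.
  rewrite subrr ifN //; apply: contra nvw => /forallP h; apply/forallP => i.
  by apply: leq_trans (h i); apply: leq_addr.
rewrite mbin_shift // addrC addKr; have lw := vw (Ordinal lj); rewrite /= in lw.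
case: (eqVneq (w l - v l)%N 0%N) => e.
  rewrite ifN //; apply/forallP => /(_ (Ordinal lj)) /=; rewrite eqxx; move: e lw; lia.
rewrite ifT; last first.
  apply/forallP => i; have := vw i; case: eqP => [->|_]; rewrite ?addn0 //.
  by move: e lw; lia.
apply: eq_mbin => i ij; split=> //; rewrite /decr; case: eqP => [->|_]; lia.
Qed.

Let monomial_tuple v k : exists r, forall w, I (theta w r - cf v k w *: 1).
Proof.
have [I0 ID IZ] := sI.
have [m vm] : exists m, (\sum_(i < j) v i <= m)%N by exists (\sum_(i < j) v i)%N.
elim: m v vm k => [|m IH] v vm k.
  have v0 (i : 'I_j) : v i = 0%N.
    by move: vm; rewrite leqn0 sum_nat_eq0 => /forallP/(_ i)/eqP.
  have [r rP] := binomial_tuple k; exists r => w; have := rP w.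
  rewrite /cf ifT; last by apply/forallP => i; rewrite v0.
  rewrite (@eq_mbin F j k k w (fun i => w i - v i)%N) // => i ij.
  by have := v0 (Ordinal ij) => /= ->; rewrite subn0.
case: (boolP [exists l : 'I_j, v l != 0%N]) => [/existsP[l vl]|]; last first.
  rewrite negb_exists => /forallP v0; apply: IH; rewrite big1 // => i _.
  by have := v0 i; rewrite negbK => /eqP.
have dm : (\sum_(i < j) decr v l i <= m)%N.
  move: vm; rewrite (bigD1 l) //= [X in (_ -> X <= _)%N](bigD1 l) //= /decr eqxx.
  under [X in (_ -> _ + X <= _)%N]eq_bigr => i il.
    rewrite (_ : (i == l :> nat) = false); first over.
    by apply/negbTE; apply: contra il => /eqP e; apply/eqP/val_inj.
  move: vl; lia.
have [r1 r1P] := IH (decr v l) dm (fun i => k i + (i == l)%:R).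
have [r2 r2P] := IH (decr v l) dm k.
exists (fun i => r1 i + (-1) *: r2 i) => w; rewrite thetaD thetaZ scaleN1r.
have -> : cf v k w = cf (decr v l) (fun i => k i + (i == l)%:R) w - cf (decr v l) k w.
  rewrite -cfS // /cf /decr.
  have E i : ((if i == l :> nat then (v i).-1 else v i) + (i == l :> nat))%N = v i.
    case: eqP => [->|_]; rewrite ?addn0 //; move: vl; lia.
  have -> : [forall i : 'I_j, (if i == l :> nat then (v i).-1 else v i) +
      (i == l :> nat) <= w i]%N = [forall i : 'I_j, v i <= w i]%N.
    by apply: eq_forallb => i; rewrite E.
  by case: ifP => // _; apply: eq_mbin => i _; rewrite E.
have swap (x y p q : R) : x - y - (p - q) = (x - p) - (y - q).
  by rewrite !opprB addrACA [RHS]addrACA; congr (_ + _); rewrite addrC.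
rewrite scalerBl swap.
by apply: subspaceB.
Qed.

(** The passage from up-sets to [Y] reflects inclusion: a tuple with series [t^v] lies in [Y U], and
    if it lay in [Y V] with [v] outside [V], its coefficient [1] would be in [I]. *)
Let Y_strict U V : upfun j U -> (forall v, V v -> U v) -> (forall r, Y U r -> Y V r) ->
  forall v, U v -> V v.
Proof.
move=> upU VU YUV v Uv; apply: NNPP => Vv; apply: I1.
have [r rP] := monomial_tuple v (fun _ => 0); have [I0 ID IZ] := sI.
have Yr : Y U r.
  move=> w Uw; have := rP w; rewrite /cf ifN ?scale0r ?subr0 //.
  by apply/forallP => vw; apply: Uw; apply: upU Uv => i ij; apply: (vw (Ordinal ij)).
have := subspaceB sI (YUV r Yr v Vv) (rP v).
rewrite opprB addrC subrK /cf ifT; last by apply/forallP.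
by rewrite /mbin big1 ?scale1r // => i _; rewrite subnn zbin_0.
Qed.

Let updev_of_dev k : forall U V, upfun j U -> upfun j V -> (forall v, V v -> U v) ->
  (forall i, (i < s)%N -> dev_lt k (J i V) (J i U)) -> updev j k V U.
Proof.
elim: k => [|k IH] U V upU upV VU dev /=.
  by apply: Y_strict => //; apply: Y_sub.
move=> c upc cUV cdec.
have ex i : exists N, (i < s)%N -> forall p, (N <= p)%N -> dev_lt k (J i (c p.+1)) (J i (c p)).
  case: (ltnP i s) => [lt|_]; last by exists 0%N.
  have [|||N NP] := dev i lt (fun p => J i (c p)); last by exists N.
  - by move=> p; apply: J_right_ideal.
  - by move=> p; split; apply: J_sub => v; have [] := cUV p v.
  - by move=> p; apply: J_sub; apply: cdec.
pose N i := proj1_sig (constructive_indefinite_description _ (ex i)).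
have NP i : (i < s)%N -> forall p, (N i <= p)%N -> dev_lt k (J i (c p.+1)) (J i (c p)).
  exact: (proj2_sig (constructive_indefinite_description _ (ex i))).
exists (\sum_(i < s) N i)%N => p Np; apply: IH => // [|i lt]; first exact: cdec.
by apply: NP => //; apply: leq_trans Np; rewrite (bigD1 (Ordinal lt)) //= leq_addr.
Qed.

(** Up-sets of [N^j] embed into a finite product of lattices of right ideals of [R], while the face
    at the origin forces deviation at least [j]. *)
Lemma kdim_lower_bound k : kdim_le R k -> (j <= k)%N.
Proof.
move=> kd; rewrite leqNgt; apply/negP => kj.
have upT : upfun j (fun _ => True) by [].
have upF : upfun j (fun _ => False) by [].
apply: (updev_face kj (v0 := fun _ => 0%N) upF upT) => //; first by move=> v _; split.
apply: updev_of_dev => // i _; apply: dev_lt_interval kd => // x ->.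
by have [] := @J_right_ideal i _ upF.
Qed.

End Lower.

(** * Noether normalization *)

Lemma seq_argmax (T : eqType) disp (O : orderType disp) (L : seq T) (f : T -> O) :
  L != [::] -> exists2 x, x \in L & forall y, y \in L -> (f y <= f x)%O.
Proof.
case: L => // a L _; elim: L a => [|b L IH] a.
  by exists a; rewrite ?mem_head // => y; rewrite inE => /eqP->.
have [x xL xP] := IH b; case: (leP (f a) (f x)) => ax.
  by exists x => [|y]; rewrite inE ?xL ?orbT // => /orP[/eqP->//|/xP].
exists a; rewrite ?mem_head // => y; rewrite inE => /orP[/eqP->//|/xP/le_trans].
by apply; apply: ltW.
Qed.

Lemma digits_eq0 (N : nat) M (d : nat -> int) :
  (forall i, (i < M)%N -> (`|d i| < N)%N) -> \sum_(i < M) N%:Z ^+ i * d i = 0 ->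
  forall i, (i < M)%N -> d i = 0.
Proof.
elim: M d => // M IH d dN; rewrite big_ord_recl /= expr0 mul1r.
have -> : \sum_(i < M) N%:Z ^+ lift ord0 i * d (lift ord0 i) =
          N%:Z * \sum_(i < M) N%:Z ^+ i * d i.+1.
  by rewrite mulr_sumr; apply: eq_bigr => i _; rewrite lift0 exprS mulrA.
set S := \sum_(i < M) _ => e.
have d0 : d 0%N = 0.
  have := dN 0%N isT; case: (eqVneq S 0) e => [->|S0 e]; first by rewrite mulr0 addr0.
  have {e} -> : d 0%N = - (N%:Z * S) by apply/eqP; rewrite -addr_eq0 e.
  rewrite abszN abszM /= ltnNge leq_pmulr // absz_gt0 //.
have S0 : S = 0.
  move/eqP: e; rewrite d0 add0r mulf_eq0 => /orP[|/eqP//].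
  by move=> /eqP N0; have := dN 0%N isT; rewrite d0; move: N0; case: (N).
by case=> [//|i] iM; apply: (IH (fun i => d i.+1)) => // l lM; apply: dN.
Qed.

Section Noether.
Variables (F : fieldType) (A : zmodType) (R : algType F) (tau : A -> A -> F) (u : A -> R).
Hypothesis H : is_twisted_group_algebra tau u.
Variables (n : nat).
Let tau0 a b : tau a b != 0. Proof. by have [] := H. Qed.

Definition supported_in_kernel co j := lspan (fun y => exists2 a, @in_kernel A co j a & y = u a).

Section Step.
Variables (co : nat -> A -> int) (I : R -> Prop) (ms : seq R) (j : nat).
Hypotheses (Hco : is_coords n co) (rI : right_ideal I) (jn : (j < n)%N).

(* For large [N] the new coordinate is injective on any given finite set of kernel
   elements, so a relation becomes a Laurent polynomial in it whose two extreme
   coefficients are monomials, hence invertible. *)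
Lemma coords_shear N : exists co' t, [/\ is_coords n co',
  (forall i a, i != j -> co' i a = co i a),
  (forall a, co' j a = \sum_(i < n - j) N%:Z ^+ i * co (j + i)%N a) &
  forall i, (i < n)%N -> co' i t = (i == j)%:R].
Proof.
pose l a := \sum_(i < n - j) N%:Z ^+ i * co (j + i)%N a.
pose co' i a := if i == j then l a else co i a.
have lE a : l a = co j a + \sum_(i < (n - j).-1) N%:Z ^+ i.+1 * co (j + i.+1)%N a.
  have : (0 < n - j)%N by rewrite subn_gt0.
  rewrite /l; case: (n - j)%N => // m _; rewrite big_ord_recl /= expr0 mul1r addn0.
  by congr (_ + _); apply: eq_bigr => i _; rewrite lift0.
have lD a b : l (a + b) = l a + l b.
  by rewrite /l -big_split; apply: eq_bigr => i _; rewrite (coD Hco) mulrDr.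
have Hco' : is_coords n co'.
  split=> [i a b|a a0|z].
  - by rewrite /co'; case: ifP => _; [apply: lD|apply: (coD Hco)].
  - apply: (co_inj Hco) => i ilt; rewrite (co0 Hco).
    have ne k : (k < n)%N -> k != j -> co k a = 0.
      by move=> kn kj; have := a0 k kn; rewrite /co' (negbTE kj).
    case: (eqVneq i j) => [->|]; last exact: ne.
    have := a0 j jn; rewrite /co' eqxx lE big1 ?addr0 // => k _.
    by have klt := ltn_ord k; rewrite ne ?mulr0 //; lia.
  have [_ _ surj] := Hco.
  have [a aP] := surj (fun i => if i == j then
    z j - \sum_(i < (n - j).-1) N%:Z ^+ i.+1 * z (j + i.+1)%N else z i).
  exists a => i ilt; rewrite /co'; case: (eqVneq i j) => [->|ij]; last by rewrite aP // (negbTE ij).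
  rewrite lE aP // eqxx; set S := \sum_(i < _) _; set S' := \sum_(i < _) _.
  suff -> : S = S' by rewrite subrK.
  apply: eq_bigr => k _; rewrite aP; last by have := ltn_ord k; lia.
  by rewrite ifN //; lia.
have [e [eP _]] := coords_basis Hco'.
exists co', (e j); split=> // [i a ij|a|i ilt].
- by rewrite /co' (negbTE ij).
- by rewrite /co' eqxx.
by rewrite eP.
Qed.

(** A torsion relation for each generator lets the new coordinate be confined to a finite window;
    the finitely many powers of [t] filling that window become part of the new generators. *)
Lemma noether_step : fin_over u co I ms j ->
  (forall m, m \in ms -> exists r, [/\ r != 0, supported_in_kernel co j r & I (m * r)]) ->
  exists co' ms', is_coords n co' /\ fin_over u co' I ms' j.+1.
Proof.
move=> fin tors; have sI := right_ideal_subspace rI.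
have ex m : exists Lc : seq A * (A -> F), m \in ms -> [/\ Lc.1 != [::], uniq Lc.1,
    forall a, a \in Lc.1 -> in_kernel co j a /\ Lc.2 a != 0 &
    I (m * \sum_(a <- Lc.1) Lc.2 a *: u a)].
  case: (boolP (m \in ms)) => [mms|_]; last by exists ([::], fun _ => 0).
  have [r [r0 rC Ir]] := tors m mms; have [L [c [uL LP rE]]] := lspan_family rC.
  exists (L, c) => _; split=> //; last by rewrite -rE.
  by apply: contraNneq r0 => /= L0; rewrite rE L0 big_nil.
pose Lc m := proj1_sig (constructive_indefinite_description _ (ex m)).
have LcP m : m \in ms -> [/\ (Lc m).1 != [::], uniq (Lc m).1,
    forall a, a \in (Lc m).1 -> in_kernel co j a /\ (Lc m).2 a != 0 &
    I (m * \sum_(a <- (Lc m).1) (Lc m).2 a *: u a)].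
  exact: (proj2_sig (constructive_indefinite_description _ (ex m))).
pose LL := flatten [seq (Lc m).1 | m <- ms].
have LLP m a : m \in ms -> a \in (Lc m).1 -> a \in LL.
  by move=> mms aL; apply/flattenP; exists (Lc m).1 => //; apply: map_f.
have bound (f : A -> nat) : exists K, forall a, a \in LL -> (f a <= K)%N.
  by exists (\sum_(a <- LL) f a)%N => a aL; rewrite (big_rem a) //= leq_addr.
have [K KP] := bound (fun a => \sum_(i < n) `|co i a|)%N.
have {}KP a i : a \in LL -> (i < n)%N -> (`|co i a| <= K)%N.
  move=> /KP/(leq_trans _) h ilt; apply: h.
  by rewrite (bigD1 (Ordinal ilt)) //= leq_addr.
have [co' [t [Hco' co'ne co'j tP]]] := coords_shear (K + K).+1.
have sep a b : a \in LL -> b \in LL -> in_kernel co j a -> in_kernel co j b ->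
    co' j a = co' j b -> a = b.
  move=> aL bL ka kb e; apply: (co_inj Hco) => i ilt.
  case: (ltnP i j) => ij; first by rewrite ka ?kb.
  apply/eqP; rewrite -subr_eq0; apply/eqP.
  have -> : i = (j + (i - j))%N by rewrite subnKC.
  apply: (@digits_eq0 (K + K).+1 (n - j) (fun i => co (j + i)%N a - co (j + i)%N b)).
  - move=> k kn; have := KP a (j + k)%N aL _; have := KP b (j + k)%N bL _; lia.
  - by under eq_bigr do rewrite mulrBr; rewrite sumrB -!co'j e subrr.
  lia.
have [D' D'P] := bound (fun a => `|co' j a|%N).
(* [D'] bounds the absolute value of the new coordinate on all supports, so [D] bounds the spread of
   any one relation. *)
pose D := (D' + D')%N.
pose ms' := [seq m * u (t *+ k) | m <- ms, k <- iota 0 D.+1].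
exists co', ms'; split=> // r.
set X := lspan _.
suff main m a : m \in ms -> in_kernel co j a -> X (m * u a).
  apply: lspan_min (fin r); first exact: lspan_subspace.
  move=> y [Iy|[m [a [mms ka ->]]]]; last exact: main.
  by apply: lspan_gen; left.
move=> mms; have [L0 uL LP IL] := LcP m mms.
set L := (Lc m).1 in L0 uL LP IL; set c := (Lc m).2 in LP IL.
have XI x : I x -> X x by move=> Ix; apply: lspan_gen; left.
have sX : subspace X by apply: lspan_subspace.
(* Translating the relation so that its term [x0] lands on [b] expresses [m * u b] by the other
   terms, because the coefficient of [x0] is a nonzero scalar. *)
have rel x0 b : x0 \in L -> (forall x, x \in L -> x != x0 -> X (m * u (x + (b - x0)))) ->
    X (m * u b).
  move=> x0L others; have [_ [_ IM]] := rI.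
  have /XI := IM _ (u (b - x0)) IL.
  rewrite -mulrA mulr_suml mulr_sumr (bigD1_seq x0) //=.
  rewrite -scalerAl (twM H) scalerA -scalerAr => Xs.
  apply: (@subspaceZ F R X (c x0 * tau x0 (b - x0))) => //.
    by rewrite mulf_neq0 //; have [] := LP _ x0L.
  rewrite [x0 + _]addrC subrK in Xs.
  rewrite -[_ *: _](addrK (\sum_(i <- L | i != x0) m * (c i *: u i * u (b - x0)))).
  apply: subspaceB => //.
  rewrite big_seq_cond; apply: subspace_sum => // x /andP[xL xx0].
  by rewrite -scalerAl (twM H) scalerA -scalerAr; apply: lspanZ; apply: others.
have window b k : in_kernel co j b -> (k <= D)%N -> co' j b = k -> X (m * u b).
  move=> kb kD bk.
  have -> : m * u b = (tau (t *+ k) (b - t *+ k))^-1 *: (m * u (t *+ k) * u (b - t *+ k)).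
    by rewrite -mulrA scalerAr -(twD H) addrC subrK.
  apply/lspanZ/lspan_gen; right; exists (m * u (t *+ k)), (b - t *+ k); split=> //.
    by apply/allpairsP; exists (m, k); split=> //; rewrite mem_iota.
  move=> i; rewrite ltnS leq_eqVlt (coB Hco') (coMn Hco') => /orP[/eqP->|ij].
    by rewrite tP // eqxx bk -natz subrr.
  rewrite tP ?(ltn_trans ij) // co'ne ?(ltn_eqF ij) // kb // mul0rn subrr //.
have dist x y : x \in L -> y \in L -> co' j x - co' j y <= D%:Z.
  move=> xL yL; have := D'P _ (LLP _ _ mms xL); have := D'P _ (LLP _ _ mms yL).
  rewrite /D; lia.
have [xmax xmaxL xmaxP] := seq_argmax (co' j) L0.
have [xmin xminL xminP] := seq_argmax (fun a => - co' j a) L0.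
have ker_sub x y b : in_kernel co j b -> x \in L -> y \in L -> in_kernel co j (x + (b - y)).
  move=> kb xL yL i ij; rewrite (coD Hco) (coB Hco) kb //.
  by have [-> //] := LP _ xL; have [-> //] := LP _ yL; rewrite subrr addr0.
have sepL x y : x \in L -> y \in L -> x != y -> co' j x != co' j y.
  move=> xL yL; apply: contraNneq => e; apply/eqP; apply: sep => //.
  - exact: LLP xL.
  - exact: LLP yL.
  - by have [] := LP _ xL.
  - by have [] := LP _ yL.
(* The window widens by one on each side. A new top value is solved for at [xmax] and a new bottom
   value at [xmin]; the separation of the coordinate puts every other term strictly inside. *)
have rec M : forall b, in_kernel co j b -> - M%:Z <= co' j b <= (D + M)%N%:Z -> X (m * u b).
  elim: M => [|M IH] b kb /andP[lo hi].
    by apply: (@window b `|co' j b|%N) => //; move: lo hi; rewrite addn0; lia.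
  case: (boolP (- M%:Z <= co' j b <= (D + M)%N%:Z)) => [/(IH _ kb)//|out].
  case: (lerP 0 (co' j b)) => sg.
    have bE : co' j b = (D + M.+1)%N%:Z by move: lo hi out; lia.
    apply: (rel xmax) => // x xL xx; apply: IH; first exact: ker_sub.
    rewrite (coD Hco') (coB Hco') bE.
    have := xmaxP x xL; have := sepL _ _ xL xmaxL xx; have := dist _ _ xmaxL xL; lia.
  have bE : co' j b = - M.+1%:Z by move: lo hi out; lia.
  apply: (rel xmin) => // x xL xx; apply: IH; first exact: ker_sub.
  rewrite (coD Hco') (coB Hco') bE.
  have := xminP x xL; have := sepL _ _ xL xminL xx; have := dist _ _ xL xminL; lia.
move=> ka; apply: (rec `|co' j a|%N) => //; lia.
Qed.

End Step.

Variables (coA : nat -> A -> int) (I : R -> Prop).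
Hypotheses (HcoA : is_coords n coA) (rI : right_ideal I) (I1 : ~ I 1).

Lemma fin_over_self co : fin_over u co I [:: 1] 0.
Proof.
move=> r; elim: (tw_span H r) => [|c _ y [a _ ->] _ IH]; first exact: lspan0.
by apply: lspanS IH; right; exists 1, a; rewrite mul1r mem_head.
Qed.

(** As long as every generator is torsion, one more coordinate can be eliminated; a generator
    without torsion gives the embedded copy of the kernel subalgebra. *)
Lemma noether_normalization : exists j co ms m,
  [/\ (j <= n)%N, is_coords n co, fin_over u co I ms j, m \in ms &
      forall r, supported_in_kernel co j r -> I (m * r) -> r = 0].
Proof.
have [g] : exists g, n = (0 + g)%N by exists n.
move: 0%N coA [:: 1] HcoA (fin_over_self coA) => j co ms Hco fin ng.
elim: g j co ms Hco fin ng => [|g IH] j co ms Hco fin ng.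
all: case: (classic (exists2 m, m \in ms &
  forall r, supported_in_kernel co j r -> I (m * r) -> r = 0)) => [[m mms mP]|N].
1,3: by exists j, co, ms, m; split=> //; lia.
all: have tors m : m \in ms -> exists r, [/\ r != 0, supported_in_kernel co j r & I (m * r)].
1,3: move=> mms; apply: NNPP => N2; apply: N; exists m => // r rC Ir.
1,2: by apply/eqP; apply/negPn/negP => r0; apply: N2; exists r.
  (* Here [j = n], so the kernel is trivial and the annihilating element is a nonzero scalar. All
     generators then lie in [I], and so does [1]. *)
  case: I1; have sI := right_ideal_subspace rI.
  apply: lspan_min (fin 1) => // y [//|[m [a [mms _ ->]]]].
  have [_ [_ IM]] := rI; apply: IM; have [r [r0 rC Ir]] := tors m mms.
  have [c cE] : exists c, r = c *: 1.
    elim: rC => [|c _ y' [b kb ->] _ [d ->]]; first by exists 0; rewrite scale0r.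
    have -> : b = 0 by apply: (co_inj Hco) => i ilt; rewrite (co0 Hco) kb //; lia.
    by exists (c * tau 0 0 + d); rewrite (tw_0 H) scalerDl scalerA.
  apply: (@subspaceZ F R I c) => //; last by rewrite -[m]mulr1 scalerAr -cE.
  by apply: contraNneq r0 => c0; rewrite cE c0 scale0r.
have jn : (j < n)%N by lia.
have [co' [ms' [Hco' fin']]] := noether_step Hco rI jn fin tors.
by apply: (IH j.+1 co' ms') => //; lia.
Qed.

(** The lower bound gives [j <= k], so the embedded subalgebra has rank at least [n - k] and
    supplies that many independent directions. *)
Lemma free_of_kdim k : kdim_le R k -> exists r (c : 'I_(n - k) -> A),
  indep I (fun s : 'X_{1..n - k} => r * u (mnm_eval c s)).
Proof.
move=> kd; have [j [co [ms [m [jn Hco fin mms mP]]]]] := noether_normalization.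
have jk := kdim_lower_bound H Hco rI I1 fin jn kd.
have [e [eP _]] := coords_basis Hco.
pose c (i : 'I_(n - k)) := e (j + i)%N; exists m, c.
have ev i s : (i < n)%N -> co i (mnm_eval c s) = \sum_(l < n - k) (i == j + l)%N%:R *+ s l.
  move=> ilt; rewrite /mnm_eval (co_sum Hco); apply: eq_bigr => l _.
  by rewrite (coMn Hco) eP.
have inj : injective (mnm_eval c).
  move=> s s' ss; apply/mnmP => l; have lt : (j + l < n)%N by have := ltn_ord l; lia.
  have sel q : co (j + l)%N (mnm_eval c q) = q l.
    rewrite ev // (bigD1 l) //= eqxx big1 ?addr0 ?natz // => l' l'l.
    by rewrite eqn_add2l eq_sym (_ : (l' == l :> nat) = false) ?mul0rn //; apply/negbTE.
  by have := sel s; rewrite ss sel => -[].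
move=> L d uL Id s sL.
have := mP (\sum_(s <- L) d s *: u (mnm_eval c s)).
have -> : m * \sum_(s <- L) d s *: u (mnm_eval c s) = \sum_(s <- L) d s *: (m * u (mnm_eval c s)).
  by rewrite mulr_sumr; apply: eq_bigr => q _; rewrite -scalerAr.
move=> /(_ _ Id) h; have {h} : \sum_(s <- L) d s *: u (mnm_eval c s) = 0.
  apply: h; apply: subspace_sum => [|q _]; first exact: lspan_subspace.
  apply/lspanZ/lspan_gen; exists (mnm_eval c q) => // i ij.
  rewrite ev; last by lia.
  by rewrite big1 // => l _; rewrite (_ : (i == j + l)%N = false) ?mul0rn //; lia.
have [_ [[free _] _]] := H.
pose d' a := \sum_(q <- L | mnm_eval c q == a) d q.
have d'E q : q \in L -> d' (mnm_eval c q) = d q.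
  move=> qL; rewrite /d'; under eq_bigl do rewrite (inj_eq inj).
  by rewrite -big_filter filter_pred1_uniq // big_seq1.
have -> : \sum_(s <- L) d s *: u (mnm_eval c s) = \sum_(a <- map (mnm_eval c) L) d' a *: u a.
  by rewrite big_map big_seq [RHS]big_seq; apply: eq_bigr => q qL; rewrite d'E.
move/free => /(_ _ (mnm_eval c s)); rewrite d'E //; apply; first by rewrite map_inj_uniq.
exact: map_f.
Qed.

End Noether.

(** * Generic freeness over F[x] *)

Section GenericFreeness.
Variables (F : fieldType) (A : zmodType) (T : algType F) (tau : A -> A -> F) (g : A -> T).
Variables (c0 : F) (x : T) (N : nat) (d : 'I_N -> A) (B : T -> Prop) (v : T).
Hypotheses (tau0 : forall a b, tau a b != 0)
  (gM : forall a b, g a * g b = tau a b *: g (a + b))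
  (g0 : g 0 = c0 *: 1) (c0_neq0 : c0 != 0)
  (gx : forall a, x * g a = g a * x)
  (dgen : forall a, exists s, a = mnm_eval d s)
  (rB : right_ideal B).
Implicit Types (s w t : 'X_{1..N}) (q f : {poly F}).

Let sB : subspace B. Proof. exact: right_ideal_subspace. Qed.
Let ev q : T := horner_alg x q.
Let evM p q : ev (p * q) = ev p * ev q. Proof. exact: rmorphM. Qed.
Let mul_evM y p q : y * ev p * ev q = y * ev (p * q). Proof. by rewrite evM mulrA. Qed.
Let evD p q : ev (p + q) = ev p + ev q. Proof. exact: rmorphD. Qed.
Let evZ c q : ev (c *: q) = c *: ev q.
Proof. by rewrite /ev linearZ /= mulr_algl. Qed.
Let evC q a : ev q * g a = g a * ev q.
Proof.
elim/poly_ind: q => [|q c IH]; first by rewrite /ev rmorph0 mul0r mulr0.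
rewrite /ev rmorphD rmorphM /= horner_algX horner_algC mulrDl mulrDr -mulrA gx !mulrA -/(ev q).
by rewrite IH mulr_algl mulr_algr.
Qed.
Let mon s := v * g (mnm_eval d s).
Let monM s t : mon s * g (mnm_eval d t) =
  tau (mnm_eval d s) (mnm_eval d t) *: mon (s + t)%MM.
Proof. by rewrite /mon -mulrA gM -scalerAr mnm_evalD. Qed.

Let low s := lspan (fun y => B y \/ exists w q, (w < s)%O /\ y = mon w * ev q).
(** The monomial is torsion over [F[x]] modulo [B] and the lower monomials. The remaining exponents,
    called standard, index a generic basis. *)
Definition torsion_mon s := exists f, f != 0 /\ low s (mon s * ev f).

Let low_ev s y q : low s y -> low s (y * ev q).
Proof.
elim=> [|c z y' Xz _ IH]; first by rewrite mul0r; apply: lspan0.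
rewrite mulrDl -scalerAl; apply: lspanS => //.
case: Xz => [Bz|[w [q' [ws ->]]]]; [left|right].
  by have [_ [_ BM]] := rB; apply: BM.
by exists w, (q' * q); rewrite evM mulrA.
Qed.

Let low_mon s t y : low s y -> low (s + t)%MM (y * g (mnm_eval d t)).
Proof.
elim=> [|c z y' Xz _ IH]; first by rewrite mul0r; apply: lspan0.
rewrite mulrDl -scalerAl; apply: lspanD => //; apply: lspanZ.
case: Xz => [Bz|[w [q' [ws ->]]]].
  by apply: lspan_gen; left; have [_ [_ BM]] := rB; apply: BM.
rewrite -mulrA evC mulrA monM -scalerAl; apply/lspanZ/lspan_gen; right.
by exists (w + t)%MM, q'; rewrite ltmc_add2l.
Qed.

Let torsion_shift s t f : low s (mon s * ev f) -> low (s + t)%MM (mon (s + t)%MM * ev f).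
Proof.
move/(low_mon t); rewrite -mulrA evC mulrA monM -scalerAl.
by apply: subspaceZ; [apply: lspan_subspace|apply: tau0].
Qed.

Lemma torsion_upset : upset torsion_mon.
Proof. by move=> s t [f [f0 lf]]; exists f; split=> //; apply: torsion_shift. Qed.

Lemma torsion_mon0 : torsion_mon 0%MM -> exists f, f != 0 /\ B (v * ev f).
Proof.
move=> [f [f0 lf]]; exists f; split=> //.
have : B (mon 0%MM * ev f).
  apply: lspan_min lf => // y [//|[w [q []]]].
  by rewrite ltNge le0x.
rewrite /mon mnm_eval0 g0 -scalerAr mulr1 -scalerAl; exact: subspaceZ.
Qed.

(** The largest exponent in a nontrivial relation would be torsion. *)
Lemma standard_indep (L : seq 'X_{1..N}) (q : 'X_{1..N} -> {poly F}) :
  uniq L -> (forall s, s \in L -> ~ torsion_mon s) ->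
  B (\sum_(s <- L) mon s * ev (q s)) -> forall s, s \in L -> q s = 0.
Proof.
move=> uL std Bs s0 s0L; apply/eqP/negPn/negP => q0.
pose L' := [seq s <- L | q s != 0].
have L'0 : L' != [::].
  have: s0 \in L' by rewrite mem_filter q0.
  by case: (L').
have [s sL' smax] := seq_argmax id L'0.
move: sL'; rewrite mem_filter => /andP[qs sL]; apply: (std s sL); exists (q s); split=> //.
have -> : mon s * ev (q s) = \sum_(s <- L) mon s * ev (q s) - \sum_(w <- L | w != s) mon w * ev (q w).
  by rewrite (bigD1_seq s) //= addrK.
apply: subspaceB; [exact: lspan_subspace|by apply: lspan_gen; left|].
rewrite big_seq_cond; apply: subspace_sum => [|w /andP[wL ws]]; first exact: lspan_subspace.
case: (eqVneq (q w) 0) => [->|qw]; first by rewrite /ev rmorph0 mulr0; apply: lspan0.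
apply: lspan_gen; right; exists w, (q w); split=> //.
by rewrite lt_neqAle ws smax // mem_filter qw.
Qed.

Lemma standard_indep_pairs (l : seq ({poly F} * 'X_{1..N})) :
  (forall p, p \in l -> ~ torsion_mon p.2) ->
  B (\sum_(p <- l) mon p.2 * ev p.1) ->
  forall s, s \in unzip2 l -> \sum_(p <- l | p.2 == s) p.1 = 0.
Proof.
have h0 s : mon s * ev 0 = 0 by rewrite /ev rmorph0 mulr0.
have hD s : {morph (fun q => mon s * ev q) : q q' / q + q'} by move=> q q'; rewrite evD mulrDr.
move=> std; rewrite (sum_pairs_merge _ h0 hD) => Bs s sl.
apply: (standard_indep (undup_uniq (unzip2 l)) _ Bs); last by rewrite mem_undup.
by move=> w; rewrite mem_undup => /mapP[p /std pP ->].
Qed.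

(** Torsion exponents form an up-set, so by Dickson's lemma the product of finitely many polynomials
    serves them all. *)
Lemma common_denominator : exists f, f != 0 /\
  forall s, torsion_mon s -> low s (mon s * ev f).
Proof.
have [L [LP Lgen]] := upset_fingen torsion_upset.
have ex s : exists f, f != 0 /\ (torsion_mon s -> low s (mon s * ev f)).
  case: (classic (torsion_mon s)) => [[f [f0 lf]]|N1]; first by exists f.
  by exists 1; rewrite oner_neq0.
pose f s := proj1_sig (constructive_indefinite_description _ (ex s)).
have fP s : f s != 0 /\ (torsion_mon s -> low s (mon s * ev (f s))).
  exact: (proj2_sig (constructive_indefinite_description _ (ex s))).
exists (\prod_(s <- L) f s); split.
  by rewrite prodf_seq_neq0; apply/allP => s _; apply/implyP => _; have [] := fP s.
move=> s /Lgen[t tL ts]; have [_ /(_ (LP t tL)) lt] := fP t.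
rewrite (big_rem t) //= evM mulrA; apply: low_ev.
by have := torsion_shift (s - t)%MM lt; rewrite addmC submK.
Qed.

Section Specialization.
Variable f : {poly F}.
Hypotheses (f0 : f != 0) (fP : forall s, torsion_mon s -> low s (mon s * ev f)).
Hypothesis std0 : ~ torsion_mon 0%MM.

(* Any nonconstant polynomial coprime to [f] would do. *)
Let p : {poly F} := 1 + 'X * f.

Let size_p : (1 < size p)%N.
Proof.
have sXf : size ('X * f) = (size f).+1 by rewrite mulrC size_mulX.
by rewrite /p addrC size_polyDl sXf ?size_poly1 ltnS size_poly_gt0.
Qed.

Lemma spec_neq0 : p != 0.
Proof. by rewrite -size_poly_gt0; apply: ltn_trans size_p. Qed.

Definition spec := lspan (fun y => B y \/ exists a q, y = v * g a * ev (q * p)).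

Lemma spec_sub y : B y -> spec y.
Proof. by move=> By; apply: lspan_gen; left. Qed.

Lemma spec_g y a : spec y -> spec (y * g a).
Proof.
elim=> [|c z y' Xz _ IH]; first by rewrite mul0r; apply: lspan0.
rewrite mulrDl -scalerAl; apply: lspanD => //; apply: lspanZ.
case: Xz => [Bz|[b [q ->]]].
  by apply: spec_sub; have [_ [_ BM]] := rB; apply: BM.
have -> : v * g b * ev (q * p) * g a = tau b a *: (v * g (b + a) * ev (q * p)).
  by rewrite -[LHS]mulrA evC mulrA -[v * g b * g a]mulrA gM -scalerAr -scalerAl.
by apply/lspanZ/lspan_gen; right; exists (b + a), q.
Qed.

Lemma spec_poly : spec (v * ev p).
Proof.
apply: (@subspaceZ F T spec c0) => //; first exact: lspan_subspace.
apply: lspan_gen; right; exists 0, 1.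
by rewrite g0 mul1r -scalerAr mulr1 -scalerAl.
Qed.

Let stdspan q0 := lspan (fun y => B y \/
  exists w q, ~ torsion_mon w /\ y = mon w * ev (q * q0)).

Let stdspan_ev q0 y q q1 : stdspan q0 y -> stdspan (q0 * q1) (y * ev (q * q1)).
Proof.
elim=> [|c z y' Xz _ IH]; first by rewrite mul0r; apply: lspan0.
rewrite mulrDl -scalerAl; apply: lspanS => //.
case: Xz => [Bz|[w [q' [ws ->]]]]; [left|right].
  by have [_ [_ BM]] := rB; apply: BM.
exists w, (q' * q); split=> //; rewrite mul_evM; congr (_ * ev _); ring.
Qed.

(** After inverting [f] the standard monomials span; the power [k] clears the denominators met while
    rewriting down the monomial order. *)
Let clear_denominators s : forall q, exists k, stdspan 1 (mon s * ev (q * f ^+ k)).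
Proof.
elim/(ltmwf (n := N)): s => s IH q.
case: (classic (torsion_mon s)) => [red|std]; last first.
  exists 0%N; apply: lspan_gen; right; exists s, q; split=> //.
have [k kP] : exists k, stdspan 1 (mon s * ev f * ev (f ^+ k)).
  elim: (fP red) => [|c z y Xz _ [k kP]].
    by exists 0%N; rewrite mul0r; apply: lspan0.
  have [k' k'P] : exists k', stdspan 1 (z * ev (f ^+ k')).
    case: Xz => [Bz|[w [q' [ws ->]]]].
      by exists 0%N; apply: lspan_gen; left; have [_ [_ BM]] := rB; apply: BM.
    by have [k' k'P] := IH w ws q'; exists k'; rewrite mul_evM.
  exists (k + k')%N; rewrite mulrDl -scalerAl; apply: lspanD.
    apply: lspanZ; have := stdspan_ev (f ^+ k) 1 k'P.
    by rewrite mul_evM !mulr1 -exprD addnC.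
  have := stdspan_ev (f ^+ k') 1 kP.
  by rewrite mul_evM !mulr1 -exprD.
exists k.+1; have -> : mon s * ev (q * f ^+ k.+1) = mon s * ev f * ev (f ^+ k) * ev (q * 1).
  by rewrite !mul_evM exprS; congr (_ * ev _); ring.
by have := stdspan_ev q 1 kP; rewrite [X in stdspan X]mulr1.
Qed.

Let clear_denominators_spec y : spec y -> exists k, stdspan p (y * ev (f ^+ k)).
Proof.
elim=> [|c z y' Xz _ [k kP]].
  by exists 0%N; rewrite mul0r; apply: lspan0.
have [k' k'P] : exists k', stdspan p (z * ev (f ^+ k')).
  case: Xz => [Bz|[a [q ->]]].
    by exists 0%N; apply: lspan_gen; left; have [_ [_ BM]] := rB; apply: BM.
  have [s ->] := dgen a; have [k' k'P] := clear_denominators s q.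
  exists k'; have := stdspan_ev 1 p k'P; rewrite [X in stdspan X]mul1r.
  suff -> : mon s * ev (q * f ^+ k') * ev (1 * p) = mon s * ev (q * p) * ev (f ^+ k') by [].
  by rewrite !mul_evM; congr (_ * ev _); ring.
have shift y0 i j : stdspan p (y0 * ev (f ^+ i)) -> stdspan p (y0 * ev (f ^+ (i + j))).
  by move=> /(stdspan_ev (f ^+ j) 1); rewrite mul_evM !mulr1 -exprD.
exists (k + k')%N; rewrite mulrDl -scalerAl; apply: lspanD; last exact: shift.
by apply: lspanZ; rewrite addnC; apply: shift.
Qed.

(** If [v] vanished in the specialization, a power of [f] times [v] would be [p] times a combination
    of standard monomials. Exponent [0] is standard, so comparing its coefficients makes [p] divide
    that power, contradicting coprimality. *)
Lemma spec_proper : ~ spec v.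
Proof.
move=> /clear_denominators_spec[k kP].
have [l lstd Bl] : exists2 l : seq ({poly F} * 'X_{1..N}),
    (forall pr, pr \in l -> ~ torsion_mon pr.2) &
    B (v * ev (f ^+ k) - \sum_(pr <- l) mon pr.2 * ev (pr.1 * p)).
  have [B0 BD BZ] := sB; elim: kP => [|c z y Xz _ [l lstd Bl]].
    by exists [::] => //; rewrite big_nil subr0.
  case: Xz => [Bz|[w [q [ws ->]]]].
    by exists l => //; rewrite -addrA; apply: BD => //; apply: BZ.
  exists ((c *: q, w) :: l).
    by move=> pr; rewrite inE => /orP[/eqP->//|/lstd].
  by rewrite big_cons /= -scalerAl evZ -scalerAr opprD addrACA subrr add0r.
pose l' := (c0^-1 *: f ^+ k, 0%MM) :: [seq (- (pr.1 * p), pr.2) | pr <- l].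
have := @standard_indep_pairs l' _ _ 0%MM (mem_head _ _).
have h1 pr : pr \in l' -> ~ torsion_mon pr.2.
  by rewrite inE => /orP[/eqP->//|/mapP[pr' /lstd ? ->]].
have h2 : B (\sum_(pr <- l') mon pr.2 * ev pr.1).
  rewrite big_cons big_map /= /mon mnm_eval0 g0 -scalerAr mulr1 evZ.
  rewrite -scalerAl -scalerAr scalerA mulfV // scale1r.
  rewrite (eq_bigr (fun pr => - (mon pr.2 * ev (pr.1 * p)))); last first.
    by move=> pr _; rewrite /ev rmorphN mulrN.
  by rewrite sumrN.
move=> /(_ h1 h2); rewrite big_cons eqxx big_map /= sumrN -big_distrl /= => /eqP.
rewrite subr_eq0 => /eqP fk.
have pf : p %| f ^+ k.
  have -> : f ^+ k = c0 *: ((\sum_(i <- l | i.2 == 0%MM) i.1) * p).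
    by rewrite -fk scalerA mulfV // scale1r.
  by rewrite dvdpZr // dvdp_mull.
have cop : coprimep p f.
  apply/Bezout_coprimepP; exists (1, - 'X) => /=.
  by rewrite (_ : 1 * p + - 'X * f = 1) ?eqpxx // /p; ring.
have /coprimepP/(_ p (dvdpp p) pf) := coprimep_expr k cop; rewrite -size_poly_eq1.
by move/eqP => s1; move: size_p; rewrite s1.
Qed.

(** Modulo [p] one has [1 = - 'X * f], so torsion monomials rewrite to lower ones without
    denominators. For standard ones, division by [p] bounds the powers of [x], which keeps the
    growth count finite over each exponent. *)
Lemma spec_reduce s : forall q, lspan (fun y => spec y \/ exists w l,
  [/\ ~ torsion_mon w, (mdeg w <= mdeg s)%N, (l < size p)%N & y = mon w * x ^+ l]) (mon s * ev q).
Proof.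
elim/(ltmwf (n := N)): s => s IH q.
have specm q' : spec (mon s * ev (q' * p)).
  by apply: lspan_gen; right; exists (mnm_eval d s), q'.
case: (classic (torsion_mon s)) => [red|std].
  have -> : mon s * ev q = mon s * ev (q * p) - mon s * ev f * ev ('X * q).
    rewrite mul_evM -mulrBr; congr (_ * _); rewrite /ev -rmorphB; congr (horner_alg x _).
    by rewrite /p; ring.
  apply: subspaceB; [exact: lspan_subspace|by apply: lspan_gen; left|].
  elim: (fP red) => [|c z y Xz _ IHl]; first by rewrite mul0r; apply: lspan0.
  rewrite mulrDl -scalerAl; apply: lspanD => //; apply: lspanZ.
  case: Xz => [Bz|[w [q' [ws ->]]]].
    by apply: lspan_gen; left; apply: spec_sub; have [_ [_ BM]] := rB; apply: BM.
  rewrite mul_evM; apply: lspan_sub (IH w ws _) => y' [sy|[w' [l [? mw ? ->]]]].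
    by apply: lspan_gen; left.
  apply: lspan_gen; right; exists w', l; split=> //; apply: leq_trans mw _.
  exact/lemc_mdeg/ltW.
rewrite (divp_eq q p) evD mulrDr; apply: lspanD; first by apply: lspan_gen; left.
rewrite -[q %% p]coefK poly_def {1}/ev rmorph_sum mulr_sumr.
apply: subspace_sum => [|l _]; first exact: lspan_subspace.
rewrite /= -/(ev _) evZ /ev rmorphXn /= horner_algX -scalerAr.
apply/lspanZ/lspan_gen; right; exists s, l; split=> //.
by apply: ltn_trans (ltn_ord l) _; rewrite ltn_modp spec_neq0.
Qed.

(** Freeness in the specialization forces the standard exponents to contain an [e]-dimensional cone
    by growth. Standard monomials are independent over [F[x]], so the powers of [x] come as an
    additional direction. *)
Lemma free_of_spec_free e (c : 'I_e -> A) y0 :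
  lspan (fun y => exists2 a, True & y = v * g a) y0 ->
  indep spec (fun k : 'X_{1..e} => y0 * g (mnm_eval c k)) ->
  exists c' : 'I_e -> A,
    indep B (fun k : 'X_{1..e} * nat => v * g (mnm_eval c' k.1) * x ^+ k.2).
Proof.
move=> y0P ind.
have [C0 C0P] : exists C0, lspan (fun y => exists2 w, (mdeg w <= C0)%N & y = mon w) y0.
  elim: y0P => [|b _ z [a _ ->] _ [C IH]]; first by exists 0%N; apply: lspan0.
  have [s ->] := dgen a; exists (maxn C (mdeg s)); apply: lspanS.
    by exists s => //; rewrite leq_maxr.
  by apply: lspan_sub IH => _ [w wC ->]; apply: lspan_gen; exists w;
     rewrite // (leq_trans wC) ?leq_maxl.
have [C1 C1P] := mnm_eval_lift dgen c.
have [S [w0 [cS cone]]] : has_cone_dim (diff (fun _ => True) torsion_mon) e.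
  apply: (@cone_of_growth F T N _ _ e spec _ (fun k => y0 * g (mnm_eval c k))
    (mnm_box e) (fun s l => mon s * x ^+ l) (C0 + C1)%N (size p)) => //.
  - exact: torsion_upset.
  - exact: lspan_subspace.
  - by move=> r; split; [apply: mnm_box_uniq|apply: size_mnm_box].
  move=> r k /mnm_boxP/C1P[t [-> tC]].
  elim: C0P => [|b _ z [w wC ->] _ IH]; first by rewrite mul0r; apply: lspan0.
  rewrite mulrDl -scalerAl monM scalerA; apply: lspanD => //; apply: lspanZ.
  have := spec_reduce (w + t)%MM 1; rewrite {1}/ev rmorph1 mulr1.
  apply: lspan_sub => y [sy|[w' [l [std mw lp ->]]]]; apply: lspan_gen; first by left.
  right; exists w', l; split=> //; apply: leq_trans mw _.
  by rewrite mdegD; move: wC tC; nia.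
(* The standard exponents are closed downwards, so the cone may be moved to the origin. *)
have stdS t : (forall i, i \notin S -> t i = 0%N) -> ~ torsion_mon t.
  move=> tS red; have [_] := cone t tS; apply.
  by rewrite addmC; apply: torsion_upset.
pose sg (i : 'I_e) : 'I_N := enum_val (cast_ord (esym cS) i).
have sg_inj : injective sg by move=> i i' /enum_val_inj/cast_ord_inj.
have sgS i : sg i \in S by apply: enum_valP.
pose emb (k : 'X_{1..e}) : 'X_{1..N} := (\sum_i U_(sg i) *+ k i)%MM.
have embE k i : emb k (sg i) = k i.
  rewrite mnm_sumE (bigD1 i) //= mulmnE mnm1E eqxx mul1n big1 ?addn0 // => i' ii'.
  by rewrite mulmnE mnm1E (inj_eq sg_inj) (negbTE ii').
have emb_inj : injective emb.
  by move=> k k' kk; apply/mnmP => i; rewrite -!embE kk.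
have embS k i : i \notin S -> emb k i = 0%N.
  move=> iS; rewrite mnm_sumE big1 // => i' _; rewrite mulmnE mnm1E.
  by case: eqP => // e'; rewrite -e' sgS in iS.
exists (fun i => d (sg i)).
have evE k : mnm_eval (fun i => d (sg i)) k = mnm_eval d (emb k).
  rewrite /emb (big_morph (mnm_eval d) (mnm_evalD d) (mnm_eval0 d)).
  apply: eq_bigr => i _; rewrite /mnm_eval (bigD1 (sg i)) //= mulmnE mnm1E eqxx mul1n.
  by rewrite big1 ?addr0 // => i' ii'; rewrite mulmnE mnm1E eq_sym (negbTE ii').
move=> L b uL BL k0 k0L.
pose l := [seq (b k *: 'X^(k.2), emb k.1) | k <- L].
have h1 pr : pr \in l -> ~ torsion_mon pr.2.
  by move=> /mapP[k _ ->] /=; apply: stdS; apply: embS.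
have h2 : B (\sum_(pr <- l) mon pr.2 * ev pr.1).
  rewrite big_map /=; suff -> : \sum_(k <- L) mon (emb k.1) * ev (b k *: 'X^(k.2)) =
    \sum_(k <- L) b k *: (v * g (mnm_eval (fun i => d (sg i)) k.1) * x ^+ k.2) by [].
  by apply: eq_bigr => k _; rewrite evZ -scalerAr evE /ev rmorphXn /= horner_algX.
have := standard_indep_pairs h1 h2 (s := emb k0.1).
have em : emb k0.1 \in unzip2 l.
  by apply/mapP; exists (b k0 *: 'X^(k0.2), emb k0.1) => //; apply/mapP; exists k0.
move=> /(_ em); rewrite big_map /= => /(congr1 (fun q : {poly F} => q`_k0.2)).
rewrite coef0 coef_sum.
rewrite (eq_bigl (fun k => k.1 == k0.1)); last by move=> k; rewrite (inj_eq emb_inj).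
rewrite big_mkcond (bigD1_seq k0) //= eqxx coefZ coefXn eqxx mulr1 big1 ?addr0 //.
move=> k kk0; case: eqP => // e1; rewrite coefZ coefXn.
case: eqP => [e2|_]; last by rewrite mulr0.
by move: kk0; rewrite -pair_eqE /pair_eq e1 e2 !eqxx.
Qed.

End Specialization.

Lemma torsion_or_specialization :
  (exists2 f : {poly F}, f != 0 & B (v * horner_alg x f)) \/
  exists (p : {poly F}) (B' : T -> Prop),
    [/\ p != 0, subspace B', subI B B', forall y a, B' y -> B' (y * g a) &
    [/\ B' (v * horner_alg x p), ~ B' v &
      forall e (c : 'I_e -> A) y0,
        lspan (fun y => exists2 a, True & y = v * g a) y0 ->
        indep B' (fun k : 'X_{1..e} => y0 * g (mnm_eval c k)) ->
        exists c' : 'I_e -> A,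
          indep B (fun k : 'X_{1..e} * nat => v * g (mnm_eval c' k.1) * x ^+ k.2)]].
Proof.
case: (classic (torsion_mon 0%MM)) => [/torsion_mon0[f [f0 Bf]]|std0]; first by left; exists f.
right; have [f [f0 fP]] := common_denominator.
exists (1 + 'X * f), (spec f); split.
- exact: spec_neq0.
- exact: lspan_subspace.
- exact: spec_sub.
- exact: spec_g.
split; [exact: spec_poly|exact: spec_proper|exact: free_of_spec_free].
Qed.

End GenericFreeness.

(** * Noncommuting monomials *)

Lemma indep_reindex (F : fieldType) (V : lmodType F) (B : V -> Prop) (K K' : eqType)
    (x : K -> V) (x' : K' -> V) (h : K' -> K) (c : K' -> F) :
  indep B x -> injective h -> (forall k, c k != 0) -> (forall k, x' k = c k *: x (h k)) ->
  indep B x'.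
Proof.
move=> ix hi c0 x'E L b uL BL k kL.
pose b' a := \sum_(q <- L | h q == a) b q * c q.
have b'E q : q \in L -> b' (h q) = b q * c q.
  move=> qL; rewrite /b'; under eq_bigl do rewrite (inj_eq hi).
  by rewrite -big_filter filter_pred1_uniq // big_seq1.
have /eqP : b' (h k) = 0.
  apply: (ix (map h L)); [by rewrite map_inj_uniq| |exact: map_f].
  rewrite big_map (_ : \sum_(j <- L) _ = \sum_(k <- L) b k *: x' k) //.
  by rewrite big_seq [RHS]big_seq; apply: eq_bigr => q qL; rewrite b'E // x'E scalerA.
by rewrite b'E // mulf_eq0 (negbTE (c0 k)) orbF => /eqP.
Qed.

Section Commutation.
Variables (F : fieldType) (A : zmodType) (R : algType F) (tau : A -> A -> F) (u : A -> R).
Hypothesis H : is_twisted_group_algebra tau u.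
Let tau0 a b : tau a b != 0. Proof. by have [] := H. Qed.

Lemma tw_comm a b : u a * u b = (tau a b / tau b a) *: (u b * u a).
Proof. by rewrite !(twM H) scalerA mulfVK // addrC. Qed.

Lemma twX a m : exists2 c, c != 0 & u a ^+ m = c *: u (a *+ m).
Proof.
elim: m => [|m [c c0 IH]].
  exists (tau 0 0)^-1; first by rewrite invr_eq0.
  by rewrite expr0 mulr0n (tw_0 H) scalerA mulVf // scale1r.
exists (c * tau a (a *+ m)); first by rewrite mulf_neq0.
by rewrite exprS IH -scalerAr (twM H) scalerA -mulrS.
Qed.

Let comm a b := u a * u b = u b * u a.

Let commD a b b' : comm a b -> comm a b' -> comm a (b + b').
Proof.
rewrite /comm => h h'; rewrite (twD H b b') -scalerAr -scalerAl; congr (_ *: _).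
by rewrite mulrA h -mulrA h' mulrA.
Qed.

Let commN a b : comm a b -> comm a (- b).
Proof.
rewrite /comm => h.
have vl : u (- b) * u b = (tau (- b) b * tau 0 0) *: 1 by rewrite (twM H) addNr (tw_0 H) scalerA.
have vr : u b * u (- b) = (tau (- b) b * tau 0 0) *: 1.
  have vr' : u b * u (- b) = (tau b (- b) * tau 0 0) *: 1 by rewrite (twM H) subrr (tw_0 H) scalerA.
  rewrite vr'; congr (_ *: _).
  have : u b * u (- b) * u b = u b * (u (- b) * u b) by rewrite mulrA.
  rewrite vl vr' -scalerAl -scalerAr mul1r mulr1 => /eqP.
  rewrite -subr_eq0 -scalerBl scaler_eq0 (negbTE (tw_neq0 H b)) orbF subr_eq0.
  by move/eqP.
have c0 : tau (- b) b * tau 0 0 != 0 by rewrite mulf_neq0.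
apply: (scalerI c0).
transitivity (u (- b) * (u b * u a) * u (- b)).
  by rewrite mulrA vl -scalerAl mul1r scalerAl.
by rewrite -h mulrA -mulrA vr -scalerAr mulr1 scalerAr.
Qed.

(** The product of the orders of the commutator scalars of [c] with a basis works as exponent. *)
Lemma tw_torsion_central n (co : nat -> A -> int) c : is_coords n co ->
  (forall b, exists2 m, (0 < m)%N & (tau c b / tau b c) ^+ m = 1) ->
  exists2 m, (0 < m)%N & forall r, u (c *+ m) * r = r * u (c *+ m).
Proof.
move=> Hco tors; have [e [_ eP]] := coords_basis Hco.
have ex b : exists m, (0 < m)%N /\ (tau c b / tau b c) ^+ m = 1.
  by have [m m0 mP] := tors b; exists m.
pose m b := proj1_sig (constructive_indefinite_description _ (ex b)).
have mP b : (0 < m b)%N /\ (tau c b / tau b c) ^+ (m b) = 1.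
  exact: (proj2_sig (constructive_indefinite_description _ (ex b))).
pose M := (\prod_(i < n) m (e i))%N.
have powcomm b l : u c ^+ l * u b = (tau c b / tau b c) ^+ l *: (u b * u c ^+ l).
  elim: l => [|l IH]; first by rewrite !expr0 mul1r mulr1 scale1r.
  rewrite !exprS -[u c * _ * _]mulrA IH -scalerAr !mulrA (tw_comm c b) -scalerAl scalerA.
  by rewrite [_ ^+ l * _]mulrC.
exists M; first by apply: prodn_gt0 => i; have [] := mP (e i).
have [k k0 kE] := twX c M.
have base (i : 'I_n) : comm (c *+ M) (e i).
  have := powcomm (e i) M; rewrite kE -scalerAl -scalerAr.
  have -> : (tau c (e i) / tau (e i) c) ^+ M = 1.
    by rewrite /M (bigD1 i) //= exprM (mP _).2 expr1n.
  by rewrite scale1r => /(scalerI k0).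
have all b : comm (c *+ M) b.
  have comm0 : comm (c *+ M) 0.
    by rewrite /comm (tw_0 H) -scalerAl -scalerAr mul1r mulr1.
  rewrite [b]eP; apply: big_ind => // [b1 b2|i _]; first exact: commD.
  have nat b' l : comm (c *+ M) b' -> comm (c *+ M) (b' *+ l).
    by move=> hb; elim: l => [|l IH]; rewrite ?mulr0n // mulrS; apply: commD.
  case: (co i b) => l; first by rewrite -pmulrn; apply: nat.
  by rewrite NegzE mulrNz -pmulrn -mulNrn; apply/nat/commN.
move=> r; elim: (tw_span H r) => [|d _ y [b _ ->] _ IH]; first by rewrite mulr0 mul0r.
by rewrite mulrDr mulrDl IH -scalerAr -scalerAl all.
Qed.

(** When all commutator scalars are roots of unity, each basis direction has a central power.
    Imposing a polynomial relation on it makes every generator torsion, so Noether steps continue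
    down to a nonzero module finite over [F], where the lower bound applies with [j = n]. *)
Lemma kdim_torsion_cocycle n (co : nat -> A -> int) k : is_coords n co ->
  (forall a b, exists2 m, (0 < m)%N & (tau a b / tau b a) ^+ m = 1) ->
  kdim_le R k -> (n <= k)%N.
Proof.
move=> Hco tors kd.
suff main g : forall I j co ms, is_coords n co -> right_ideal I -> ~ I 1 ->
    fin_over u co I ms j -> n = (j + g)%N -> (n <= k)%N.
  apply: (main n (fun y : R => y = 0) 0%N co [:: 1]) => //.
  - by split=> //; split=> [y z -> ->|y r ->]; rewrite ?addr0 ?mul0r.
  - by apply/eqP; rewrite oner_neq0.
  - exact: (fin_over_self H).
elim: g => [|g IH] I j {}co ms {}Hco rI I1 fin ng.
  rewrite addn0 in ng; have := kdim_lower_bound H Hco rI I1 fin _ kd.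
  by rewrite -ng; apply.
have jn : (j < n)%N by lia.
have [e [eP _]] := coords_basis Hco.
have [M M0 zC] := tw_torsion_central Hco (tors (e j)).
set z := u (e j *+ M) in zC.
have [d [dgen _]] := coords_generators Hco.
have gx a : z * u a = u a * z by apply: zC.
(* Either [I] already contains a nonzero polynomial in [z], or a specialization enlarges it to a
   proper right ideal that does. *)
have [J [p [rJ IJ J1 p0 Jp]]] : exists (J : R -> Prop) (p : {poly F}),
    [/\ right_ideal J, subI I J, ~ J 1, p != 0 & J (horner_alg z p)].
  have [[f f0 If]|] := torsion_or_specialization 1 tau0 (twM H) (tw_0 H) (tau0 0 0) gx dgen rI.
    by exists I, f; rewrite mul1r in If; split.
  move=> [p [J [p0 sJ IJ Ju [Jp J1 _]]]]; rewrite mul1r in Jp.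
  by exists J, p; split=> //; apply: (tw_right_ideal H).
have evE : horner_alg z p = \sum_(i < size p) p`_i *: z ^+ i.
  rewrite -{1}[p]coefK poly_def rmorph_sum; apply: eq_bigr => i _.
  by rewrite /= linearZ /= rmorphXn /= horner_algX mulr_algl.
have zX i : exists2 b, b != 0 & z ^+ i = b *: u (e j *+ (M * i)).
  by have [b b0 bE] := twX (e j *+ M) i; exists b; rewrite // bE mulrnA.
have [||co' [ms' [Hco' fin']]] := @noether_step _ _ _ _ _ H n co J ms j Hco rJ jn.
- move=> r; apply: lspan_sub (fin r) => y [Iy|Xy]; apply: lspan_gen; last by right.
  by left; apply: IJ.
- move=> m mms; exists (horner_alg z p); split.
  + rewrite evE; apply/eqP => ev0; have [_ [[free _] _]] := H.
    have exb i : exists b, b != 0 /\ z ^+ i = b *: u (e j *+ (M * i)).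
      by have [b b0 bE] := zX i; exists b.
    pose b i := proj1_sig (constructive_indefinite_description _ (exb i)).
    have bP i : b i != 0 /\ z ^+ i = b i *: u (e j *+ (M * i)).
      exact: (proj2_sig (constructive_indefinite_description _ (exb i))).
    have coe i : co j (e j *+ (M * i)) = (M * i)%N.
      by rewrite (coMn Hco) eP // eqxx -[RHS]natz.
    have inj : injective (fun i => e j *+ (M * i)).
      move=> i i' ii; have := coe i; rewrite ii coe => -[] /eqP.
      by rewrite eqn_mul2l eqn0Ngt M0 => /eqP.
    have : indep (fun y : R => y = 0) (fun i : nat => z ^+ i).
      apply: (@indep_reindex F R _ A nat u _ (fun i => e j *+ (M * i)) b) => //.
      + by move=> i; have [] := bP i.
      + by move=> i; have [] := bP i.
    move=> /(_ (iota 0 (size p)) (fun i => p`_i) (iota_uniq _ _)).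
    have -> : \sum_(k <- iota 0 (size p)) p`_k *: z ^+ k = \sum_(i < size p) p`_i *: z ^+ i.
      by rewrite -(big_mkord xpredT (fun i => p`_i *: z ^+ i)) /index_iota subn0.
    move=> /(_ ev0 (size p).-1); rewrite mem_iota add0n prednK ?size_poly_gt0 // leqnn.
    move=> /(_ isT) /eqP; rewrite -[_`_ _]/(lead_coef p) lead_coef_eq0; exact/negP.
  + rewrite evE; apply: subspace_sum => [|i _]; first exact: lspan_subspace.
    have [b b0 ->] := zX i; rewrite scalerA; apply/lspanZ/lspan_gen.
    exists (e j *+ (M * i)) => // l lj; rewrite (coMn Hco) eP ?(ltn_trans lj) //.
    by rewrite (ltn_eqF lj) mul0rn.
  have -> : m * horner_alg z p = horner_alg z p * m.
    rewrite evE mulr_sumr mulr_suml; apply: eq_bigr => i _.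
    rewrite -scalerAl -scalerAr; congr (_ *: _).
    elim: (nat_of_ord i) => [|l IHl]; first by rewrite !expr0 mul1r mulr1.
    by rewrite exprSr mulrA IHl -!mulrA -zC.
  by have [_ [_ JM]] := rJ; apply: JM.
by apply: (IH J j.+1 co' ms') => //; lia.
Qed.

Lemma exists_nontorsion n (co : nat -> A -> int) k : is_coords n co ->
  kdim_le R k -> (k < n)%N ->
  exists a b, forall m, (0 < m)%N -> (tau a b / tau b a) ^+ m != 1.
Proof.
move=> Hco kd kn; apply: NNPP => N.
have : (n <= k)%N; last by rewrite leqNgt kn.
apply: (kdim_torsion_cocycle Hco) => // a b; apply: NNPP => N2; apply: N; exists a, b => m m0.
by apply/eqP => e; apply: N2; exists m.
Qed.

End Commutation.

(** * The tensor product *)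

Section PolyAction.
Variables (F : fieldType) (T : algType F).

Lemma horner_alg_coef (x : T) (p : {poly F}) m : (size p <= m)%N ->
  horner_alg x p = \sum_(i < m) p`_i *: x ^+ i.
Proof.
move=> pm; have {1}-> : p = \poly_(i < m) p`_i.
  apply/polyP => i; rewrite coef_poly; case: ltnP => // mi.
  by rewrite nth_default // (leq_trans pm).
rewrite poly_def rmorph_sum; apply: eq_bigr => i _.
by rewrite /= linearZ /= rmorphXn /= horner_algX mulr_algl.
Qed.

Definition dilate (c : F) (p : {poly F}) := \poly_(i < size p) (c ^+ i * p`_i).

Lemma coef_dilate c p i : (dilate c p)`_i = c ^+ i * p`_i.
Proof.
rewrite coef_poly; case: ltnP => // pi.
by rewrite nth_default ?mulr0.
Qed.

Lemma horner_alg_dilate (x y : T) q p l : x * y = q *: (y * x) ->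
  horner_alg x p * y ^+ l = y ^+ l * horner_alg x (dilate (q ^+ l) p).
Proof.
move=> xy.
have xyl : x * y ^+ l = q ^+ l *: (y ^+ l * x).
  elim: l => [|l IH]; first by rewrite !expr0 mulr1 mul1r scale1r.
  rewrite exprS [LHS]mulrA xy -scalerAl -[y * x * _]mulrA IH -scalerAr scalerA [y * (_ * _)]mulrA.
  by rewrite -exprS.
have xiyl i : x ^+ i * y ^+ l = (q ^+ l) ^+ i *: (y ^+ l * x ^+ i).
  elim: i => [|i IH]; first by rewrite !expr0 mulr1 mul1r scale1r.
  rewrite exprSr -[LHS]mulrA xyl -scalerAr [x ^+ i * (_ * x)]mulrA IH -scalerAl scalerA.
  by rewrite -exprS -[_ * x ^+ i * x]mulrA.
rewrite (horner_alg_coef x (leqnn (size p))) (@horner_alg_coef x _ (size p)) ?size_poly //.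
rewrite mulr_suml mulr_sumr; apply: eq_bigr => i _.
by rewrite coef_dilate -scalerAl -scalerAr xiyl scalerA mulrC.
Qed.

End PolyAction.

Section Tensor.
Variables (F : fieldType) (A1 A2 : zmodType) (R1 R2 T : algType F).
Variables (tau1 : A1 -> A1 -> F) (tau2 : A2 -> A2 -> F).
Variables (u1 : A1 -> R1) (u2 : A2 -> R2) (w : A1 * A2 -> T).
Hypotheses (H1 : is_twisted_group_algebra tau1 u1)
  (H2 : is_twisted_group_algebra tau2 u2)
  (HT : is_twisted_group_algebra (prod_cocycle tau1 tau2) w).
Variables (n1 n2 : nat) (co1 : nat -> A1 -> int) (co2 : nat -> A2 -> int).
Hypotheses (Hco1 : is_coords n1 co1) (Hco2 : is_coords n2 co2).
Variables (k1 k2 : nat).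
Hypotheses (kd1 : kdim_le R1 k1) (kd2 : kdim_le R2 k2) (k1n : (k1 < n1)%N).

Let tau1_0 a b : tau1 a b != 0. Proof. by have [] := H1. Qed.
Let tau2_0 a b : tau2 a b != 0. Proof. by have [] := H2. Qed.

Let g a := w (0, a).
Let h a := w (a, 0).
Let gtau a b := tau1 0 0 * tau2 a b.

Let gtau0 a b : gtau a b != 0. Proof. by rewrite mulf_neq0. Qed.

Let gM a b : g a * g b = gtau a b *: g (a + b).
Proof.
rewrite /g (twM HT) /prod_cocycle /=; congr (_ *: w _).
by congr (_, _); rewrite addr0.
Qed.

Let g0 : g 0 = gtau 0 0 *: 1. Proof. exact: (tw_0 HT). Qed.

Let hgw a b : w (a, b) = (tau1 0 0 * tau2 0 0)^-1 *: (g b * h a).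
Proof.
rewrite (twM HT) /prod_cocycle /= (tau_0l H1) (tau_0r H2) scalerA mulVf ?mulf_neq0 // scale1r.
by congr (w (_, _)); rewrite ?add0r ?addr0.
Qed.

Let hg a b : h a * g b = g b * h a.
Proof.
rewrite !(twM HT) /prod_cocycle /= (tau_0l H1) (tau_0r H1) (tau_0l H2) (tau_0r H2).
by congr (_ *: w (_, _)); rewrite ?add0r ?addr0.
Qed.

Let hh a b : h a * h b = (tau1 a b / tau1 b a) *: (h b * h a).
Proof.
rewrite (tw_comm HT) /prod_cocycle /=; congr (_ *: _).
by rewrite invfM mulrACA mulfV // mulr1.
Qed.

Let m := (n2 - k2)%N.

(** The annihilator of [v] is pulled back along the linear map sending [u2 a] to [g a], which is
    multiplicative up to a scalar. Stability under [g] alone is assumed of [B], as this is what a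
    specialization provides. *)
Lemma free_over_second (B : T -> Prop) v : subspace B -> (forall y a, B y -> B (y * g a)) -> ~ B v ->
  exists (r0 : T) (c : 'I_m -> A2),
    lspan (fun y => exists2 a, True & y = g a) r0 /\
    indep B (fun s : 'X_{1..m} => v * r0 * g (mnm_eval c s)).
Proof.
move=> sB Bg Bv; have [_ [ub _]] := H2; have [B0 BD BZ] := sB.
have [f fE] := basis_linear_extension g ub.
have fM r a : f (r * u2 a) = (tau1 0 0)^-1 *: (f r * g a).
  elim: (tw_span H2 r) => [|c _ y [b _ ->] _ IH].
    by rewrite mul0r linear0 mul0r scaler0.
  rewrite mulrDl -scalerAl (twM H2) scalerA !linearP /= IH !fE mulrDl scalerDr; congr (_ + _).
  rewrite -scalerAl gM /gtau !scalerA; congr (_ *: _).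
  by field; apply: tau1_0.
have rI : right_ideal (fun r => B (v * f r)).
  apply: (tw_right_ideal H2); first split.
  - by rewrite linear0 mulr0.
  - by move=> y z By Bz; rewrite linearD mulrDr; apply: BD.
  - by move=> c y By; rewrite linearZ -scalerAr; apply: BZ.
  by move=> y a By; rewrite fM -scalerAr mulrA; apply/BZ/Bg.
have I1 : ~ B (v * f 1).
  move=> B1; apply: Bv; have : f (u2 0) = g 0 by rewrite fE.
  rewrite (tw_0 H2) linearZ g0 /= => f1.
  have := BZ (tau2 0 0) _ B1; rewrite scalerAr f1 -scalerAr mulr1.
  exact: subspaceZ.
have [r [c ind]] := free_of_kdim H2 Hco2 rI I1 kd2.
exists (f r), c; split.
  elim: (tw_span H2 r) => [|b _ y [a _ ->] _ IH]; first by rewrite linear0; apply: lspan0.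
  by rewrite linearP fE; apply: lspanS => //; exists a.
move=> L b uL BL; apply: ind => //.
rewrite linear_sum mulr_sumr /=.
have -> : \sum_(s <- L) v * f (b s *: (r * u2 (mnm_eval c s))) =
    (tau1 0 0)^-1 *: \sum_(s <- L) b s *: (v * f r * g (mnm_eval c s)).
  rewrite scaler_sumr; apply: eq_bigr => s _.
  by rewrite linearZ /= fM -!scalerAr mulrA !scalerA mulrC.
exact: BZ.
Qed.

Section Free.
Variables (B : T -> Prop) (v : T) (a b : A1).
Hypotheses (rB : right_ideal B) (Bv : ~ B v).
Let x := h a.
Let y := h b.
Let q := tau1 a b / tau1 b a.
Hypothesis nt : forall l, (0 < l)%N -> q ^+ l != 1.
Let sB : subspace B. Proof. exact: right_ideal_subspace. Qed.
Let BM z r : B z -> B (z * r). Proof. by have [_ [_ h']] := rB; apply: h'. Qed.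
Let ev p := horner_alg x p.

Let evg p r : lspan (fun y => exists2 a, True & y = g a) r -> ev p * r = r * ev p.
Proof.
move=> rP; rewrite /ev (horner_alg_coef x (leqnn (size p))) mulr_suml mulr_sumr.
apply: eq_bigr => i _; rewrite -scalerAl -scalerAr; congr (_ *: _).
elim: rP => [|c _ z [e _ ->] _ IH]; first by rewrite mul0r mulr0.
rewrite mulrDl mulrDr IH -scalerAl -scalerAr; congr (_ *: _ + _).
elim: (nat_of_ord i) => [|l IHl]; first by rewrite !expr0 mul1r mulr1.
by rewrite exprS -mulrA IHl !mulrA hg.
Qed.

Let q_neq0 : q != 0. Proof. by rewrite mulf_neq0 ?invr_neq0. Qed.

Let q_inj l l' d : (0 < d)%N -> (q ^+ l) ^+ d = (q ^+ l') ^+ d -> l = l'.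
Proof.
move=> d0.
have aux i j : (i < j)%N -> (q ^+ i) ^+ d != (q ^+ j) ^+ d.
  move=> ij; rewrite -!exprM; apply/eqP => e.
  have := nt (l := (j - i) * d); rewrite muln_gt0 subn_gt0 ij d0 => /(_ isT) /eqP; apply.
  apply: (mulfI (expf_neq0 (i * d) q_neq0)).
  by rewrite -exprD mulr1 -mulnDl subnKC // ltnW.
by move=> e; case: (ltngtP l l') => // /aux; rewrite e eqxx.
Qed.

(** Elements killed by [p] are moved by [y ^+ l] to elements killed by [P l], that is [p] with
    [q^l x] substituted for [x]. Minimality of [p] makes these kernels independent for distinct
    [l]. *)
Lemma free_torsion f : f != 0 -> B (v * ev f) ->
  exists (r0 : T) (c : 'I_m -> A2),
    indep B (fun k : 'X_{1..m} * nat => v * r0 * g (mnm_eval c k.1) * y ^+ k.2).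
Proof.
move=> f0 Bf.
have [p [r1 [p0 Bp Br1 pmin]]] : exists (p : {poly F}) (r1 : T),
    [/\ p != 0, B (v * r1 * ev p), ~ B (v * r1) &
     forall (p' : {poly F}) r', p' != 0 -> (size p' < size p)%N ->
       B (v * r' * ev p') -> B (v * r')].
  have [M fM] : exists M, (size f <= M)%N by exists (size f).
  have [r1 [Br1 Bf1]] : exists r1, ~ B (v * r1) /\ B (v * r1 * ev f).
    by exists 1; rewrite mulr1.
  elim: M f f0 fM r1 Br1 Bf1 {Bf} => [|M IH] f f0 fM r1 Br1 Bf1.
    by move: fM; rewrite leqn0 size_poly_eq0 (negbTE f0).
  case: (classic (exists (p' : {poly F}) r', [/\ p' != 0, (size p' < size f)%N,
      B (v * r' * ev p') & ~ B (v * r')])) => [[p' [r' [p'0 sp' Bp' Br']]]|N].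
    by apply: (IH p' p'0 _ r') => //; rewrite -ltnS (leq_trans sp').
  exists f, r1; split=> // p' r' p'0 sp' Bp'; apply: NNPP => Br'.
  by apply: N; exists p', r'.
have Bx z : B (z * x) -> B z by apply: (twMK HT).
have By l z : B (z * y ^+ l) -> B z.
  elim: l z => [|l IH] z; first by rewrite expr0 mulr1.
  by rewrite exprS mulrA => /IH; apply: (twMK HT).
(* division by [x] lowers the degree without changing membership in [B] *)
have minX (p' : {poly F}) r' : p' != 0 -> (size p' <= size p)%N -> p'`_0 = 0 ->
    B (v * r' * ev p') -> B (v * r').
  move=> p'0 sp' c0.
  have [p2 p2E] : exists p2, p' = p2 * 'X.
    have /factor_theorem[p2 ->] : root p' 0 by rewrite rootE horner_coef0 c0.
    by exists p2; rewrite subr0.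
  have p20 : p2 != 0 by apply: contraNneq p'0 => e; rewrite p2E e mul0r.
  rewrite p2E /ev rmorphM /= horner_algX mulrA => /Bx; apply: pmin => //.
  by apply: leq_trans sp'; rewrite p2E size_mulX.
have p_0 : p`_0 != 0.
  by apply/eqP => /(minX p r1 p0 (leqnn _))/(_ Bp).
have sp : (1 < size p)%N.
  rewrite ltnNge; apply/negP => /size1_polyC pC; apply: Br1.
  move: Bp; rewrite pC /ev horner_algC -scalerAr mulr1.
  exact: subspaceZ.
pose P l := dilate (q ^+ l) p.
(* The constant terms agree and cancel. The leading coefficients differ because [p] has positive
   degree and [q] is not a root of unity. *)
have P_diff K l : K != l -> [/\ P K - P l != 0, (size (P K - P l)%R <= size p)%N &
    (P K - P l)`_0 = 0].
  move=> Kl; split.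
  - apply/eqP => /(congr1 (fun s : {poly F} => s`_(size p).-1)).
    rewrite coef0 coefB !coef_dilate -mulrBl => /eqP; rewrite mulf_eq0.
    rewrite -[p`__]/(lead_coef p) lead_coef_eq0 (negbTE p0) orbF subr_eq0 => /eqP.
    by move/q_inj => e; rewrite e ?eqxx // in Kl; rewrite -subn1 subn_gt0.
  - by rewrite (leq_trans (size_polyD _ _)) // size_polyN geq_max !size_poly.
  - by rewrite coefB !coef_dilate !expr0 subrr.
(* As with eigenvectors: multiplying by [ev (P K)] kills the first term, induction treats the
   others, and an element killed by both [P K] and [P l] is killed by their difference, hence lies
   in [B]. *)
have split_sum (Ls : seq nat) : forall r : nat -> T, uniq Ls ->
    (forall l, l \in Ls -> B (v * r l * ev (P l))) -> B (\sum_(l <- Ls) v * r l) ->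
    forall l, l \in Ls -> B (v * r l).
  elim: Ls => // K Ls IH r /= /andP[KLs uLs] Pl; rewrite big_cons => Bs.
  have others l : l \in Ls -> B (v * r l).
    move=> lL; have Kl : K != l by apply: contraNneq KLs => ->.
    have [d0 sd cd] := P_diff K l Kl; apply: (minX _ (r l) d0 sd cd).
    rewrite /ev rmorphB mulrBr; apply: subspaceB => //; last by apply: Pl; rewrite inE lL orbT.
    rewrite -mulrA; apply: (IH (fun l => r l * ev (P K))) => // [l' l'L|].
      rewrite -!mulrA -rmorphM [P K * _]mulrC rmorphM !mulrA.
      by apply: BM; apply: Pl; rewrite inE l'L orbT.
    have := BM (ev (P K)) Bs; rewrite mulrDl mulr_suml.
    under eq_bigr do rewrite -mulrA.
    move=> Bs2; have := Pl K (mem_head _ _) => BK.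
    by have := subspaceB sB Bs2 BK; rewrite addrC addKr.
  move=> l; rewrite inE => /orP[/eqP->|]; last exact: others.
  have Bo : B (\sum_(l <- Ls) v * r l) by apply: subspace_sum_seq.
  by have := subspaceB sB Bs Bo; rewrite addrK.
have [r0 [c [r0g ind]]] := @free_over_second B (v * r1) sB (fun z a => @BM z (g a)) Br1.
exists (r1 * r0), c => L d uL BL k kL.
pose l := [seq (d k *: (v * (r1 * r0) * g (mnm_eval c k.1)), k.2) | k <- L].
have BL' : B (\sum_(pr <- l) pr.1 * y ^+ pr.2).
  rewrite big_map /= (_ : \sum_(j <- L) _ = \sum_(k <- L)
    d k *: (v * (r1 * r0) * g (mnm_eval c k.1) * y ^+ k.2)) //.
  by apply: eq_bigr => k' _; rewrite -scalerAl.
have hz i : (0 : T) * y ^+ i = 0 by rewrite mul0r.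
have hD i : {morph (fun z => z * y ^+ i) : z z' / z + z'} by move=> z z'; rewrite mulrDl.
rewrite (sum_pairs_merge l hz hD) in BL'.
pose rr i := r1 * r0 * (\sum_(k <- L | k.2 == i) d k *: g (mnm_eval c k.1)).
have rrE i : \sum_(pr <- l | pr.2 == i) pr.1 = v * rr i.
  rewrite big_map /= /rr [RHS]mulrA mulr_sumr; apply: eq_bigr => k' _.
  by rewrite -scalerAr.
have Brr i : B (v * rr i * ev p).
  rewrite /rr -!mulrA -evg; last first.
    apply: subspace_sum => [|k' _]; first exact: lspan_subspace.
    by apply/lspanZ/lspan_gen; exists (mnm_eval c k'.1).
  rewrite [r0 * _]mulrA -(evg p r0g) !mulrA; do 2 apply: BM; exact: Bp.
have kl : k.2 \in undup (unzip2 l).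
  by rewrite mem_undup; apply/mapP; exists (d k *: (v * (r1 * r0) * g (mnm_eval c k.1)), k.2) => //;
     apply/mapP; exists k.
have : B (v * (rr k.2 * y ^+ k.2)).
  apply: (split_sum _ (fun i => rr i * y ^+ i) (undup_uniq (unzip2 l))) => //.
    (* Moving [y ^+ i] to the left past the polynomial turns [P i] back into [p], which kills
       [v * rr i]. *)
    move=> i _; rewrite -!mulrA /P -(horner_alg_dilate p i (hh a b)) !mulrA.
    by apply: BM; have := Brr i; rewrite /rr !mulrA.
  by move: BL'; rewrite /=; under eq_bigr do rewrite rrE -mulrA.
rewrite mulrA => /By; rewrite /rr -!mulrA mulr_sumr mulr_sumr mulr_sumr => Bk.
pose L' := [seq k' <- L | k'.2 == k.2].
have := ind [seq k'.1 | k' <- L'] (fun s => d (s, k.2)) _ _ k.1.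
rewrite -surjective_pairing; apply.
- rewrite map_inj_in_uniq ?filter_uniq // => -[s1 i1] [s2 i2].
  by rewrite !mem_filter /= => /andP[/eqP-> _] /andP[/eqP-> _] ->.
- rewrite big_map big_filter; move: Bk; congr B; apply: eq_bigr => -[s i] /= /eqP->.
  by rewrite -!scalerAr !mulrA.
by apply/mapP; exists k => //; rewrite mem_filter eqxx.
Qed.

Lemma free_family : exists (r0 : T) (c : 'I_m -> A2) (e : A1),
    indep B (fun k : 'X_{1..m} * nat => v * r0 * g (mnm_eval c k.1) * h e ^+ k.2).
Proof.
have [d [dgen _]] := coords_generators Hco2.
have [[f f0 Bf]|] := torsion_or_specialization v gtau0 gM g0 (gtau0 0 0) (hg a) dgen rB.
  by have [r0 [c ind]] := free_torsion f0 Bf; exists r0, c, b.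
move=> [p [B' [p0 sB' BB' B'g [_ B'v lift]]]].
have [r0 [c [r0g ind]]] := free_over_second sB' B'g B'v.
have [|c' ind'] := lift m c (v * r0) _ ind; last by exists 1, c', a; rewrite mulr1.
elim: r0g => [|d' _ z [e _ ->] _ IH]; first by rewrite mulr0; apply: lspan0.
by rewrite mulrDr -scalerAr; apply: lspanS => //; exists e.
Qed.

End Free.

(** The [m] directions from the second factor and the one from the first give freeness of rank
    [m.+1] in every nonzero cyclic module. Coordinate [0] of [c'] carries the direction from the
    first factor. *)
Lemma kdim_tensor_le : kdim_le T (n1 + n2 - m.+1).
Proof.
have [a [b nt]] := exists_nontorsion H1 Hco1 kd1 k1n.
have [co Hco] := prod_coords Hco1 Hco2.
have [d [dgen dpair]] := coords_generators Hco.
apply: (kdim_le_of_free HT dgen dpair) => J v rJ Jv.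
have [r0 [c [e ind]]] := free_family rJ Jv nt.
pose c' (i : 'I_m.+1) : A1 * A2 := if unlift ord0 i is Some i' then (0, c i') else (e, 0).
exists r0, c'.
pose tl (k : 'X_{1..m.+1}) := [multinom k (lift ord0 i) | i < m]%MM.
have ex (k : 'X_{1..m.+1}) : exists b, b != 0 /\
    w (mnm_eval c' k) = b *: (g (mnm_eval c (tl k)) * h e ^+ k ord0).
  have [q q0 qE] := twX HT (e, 0) (k ord0).
  exists ((tau1 0 0 * tau2 0 0)^-1 * q^-1); split.
    by rewrite mulf_neq0 ?invr_neq0 ?mulf_neq0.
  rewrite -/(h e) in qE; rewrite qE -scalerAr scalerA -mulrA mulVf // mulr1.
  have pX (p : A1) i : (p, 0 : A2) *+ i = (p *+ i, 0).
    by elim: i => [|i IH]; rewrite ?mulr0n // !mulrS IH; congr (_, _); rewrite /= addr0.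
  have pX2 (p : A2) i : (0 : A1, p) *+ i = (0, p *+ i).
    by elim: i => [|i IH]; rewrite ?mulr0n // !mulrS IH; congr (_, _); rewrite /= addr0.
  rewrite pX -/(h _) -hgw; congr w.
  rewrite /mnm_eval big_ord_recl {1}/c' unlift_none pX.
  have -> : \sum_(i < m) c' (lift ord0 i) *+ k (lift ord0 i) = (0, \sum_i c i *+ tl k i).
    have pD : {morph (pair 0 : A2 -> A1 * A2) : z z' / z + z'}.
      by move=> z z'; congr (_, _); rewrite /= addr0.
    rewrite (big_morph (pair 0 : A2 -> A1 * A2) pD (erefl _)).
    by apply: eq_bigr => i _; rewrite /c' liftK pX2 mnmE.
  by congr (_, _); rewrite /= ?addr0 ?add0r.
pose bb k := proj1_sig (constructive_indefinite_description _ (ex k)).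
have bbP k : bb k != 0 /\ w (mnm_eval c' k) = bb k *: (g (mnm_eval c (tl k)) * h e ^+ k ord0).
  exact: (proj2_sig (constructive_indefinite_description _ (ex k))).
apply: (indep_reindex (h := fun k => (tl k, k ord0)) (c := bb) ind).
- move=> k k' /eqP; rewrite xpair_eqE => /andP[/eqP tk /eqP k0]; apply/mnmP => i; case: (unliftP ord0 i) => [i' ->|->//].
  by have := congr1 (fun t : 'X_{1..m} => t i') tk; rewrite !mnmE.
- by move=> k; have [] := bbP k.
by move=> k; have [_ ->] := bbP k; rewrite -scalerAr mulrA.
Qed.

End Tensor.

(** * Existence of the dimension, symmetry of the factors, and the final bound *)

Lemma kdim_exists (R : ringType) K : kdim_le R K ->
  exists2 d, krull_dim R d & (d <= K)%N.
Proof.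
elim: K {-2}K (leqnn K) => [|M IH] K KM kd.
  by exists K => //; split=> // j; move: KM; rewrite leqn0 => /eqP->.
case: (classic (exists2 j, (j < K)%N & kdim_le R j)) => [[j jK kj]|N].
  have [|d kd' dj] := IH j _ kj; first by rewrite -ltnS (leq_trans jK).
  by exists d; rewrite // (leq_trans dj) // ltnW.
by exists K => //; split=> // j jK kj; apply: N; exists j.
Qed.

Lemma kdim_le_leq (R : ringType) K K' : (K <= K')%N -> kdim_le R K -> kdim_le R K'.
Proof.
move=> le kd.
have mono k : forall B A : R -> Prop, dev_lt k B A -> dev_lt k.+1 B A.
  elim: k => [|k IH] B A.
    move=> AB c rc cAB _; exists 0%N => i _ x.
    have [_ cA] := cAB i; have [Bc _] := cAB i.+1.
    by move=> /cA/AB/Bc.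
  move=> d c rc cAB cd; have [M MP] := d c rc cAB cd.
  by exists M => i Mi; apply: IH; apply: MP.
by move: le; elim: K' => [|K' IH]; rewrite leq_eqVlt => /orP[/eqP<-//|//] /IH; apply: mono.
Qed.

Lemma twisted_swap (F : fieldType) (A1 A2 : zmodType) (T : algType F)
    (tau1 : A1 -> A1 -> F) (tau2 : A2 -> A2 -> F) (w : A1 * A2 -> T) :
  is_twisted_group_algebra (prod_cocycle tau1 tau2) w ->
  is_twisted_group_algebra (prod_cocycle tau2 tau1) (fun a : A2 * A1 => w (a.2, a.1)).
Proof.
move=> [t0 [[free gen] wM]]; split; [|split; [split|]].
- by move=> a b; have := t0 (a.2, a.1) (b.2, b.1); rewrite /prod_cocycle mulrC.
- move=> s c us e a as_.
  have := free [seq (b.2, b.1) | b <- s] (fun b => c (b.2, b.1)) _ _ (a.2, a.1).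
  rewrite /= -surjective_pairing; apply.
  + by rewrite map_inj_uniq // => -[x y] [x' y'] [-> ->].
  + by rewrite big_map -[RHS]e; apply: eq_bigr => b _ /=; rewrite -surjective_pairing.
  by apply/mapP; exists a.
- move=> x; have [s [c ->]] := gen x.
  exists [seq (b.2, b.1) | b <- s], (fun b => c (b.2, b.1)).
  by rewrite big_map; apply: eq_bigr => b _ /=; rewrite -surjective_pairing.
by move=> a b; rewrite wM /prod_cocycle /= mulrC.
Qed.

Theorem theorem5p7 (F : fieldType) (n1 n2 : nat) (R1 R2 T : algType F)
  (tau1 : 'rV[int]_n1 -> 'rV[int]_n1 -> F) (tau2 : 'rV[int]_n2 -> 'rV[int]_n2 -> F)
  (u1 : 'rV[int]_n1 -> R1) (u2 : 'rV[int]_n2 -> R2)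
  (w : 'rV[int]_n1 * 'rV[int]_n2 -> T)
  (H1 : is_twisted_group_algebra tau1 u1)
  (H2 : is_twisted_group_algebra tau2 u2)
  (HT : is_twisted_group_algebra (prod_cocycle tau1 tau2) w)
  (k1 k2 : nat) (hk1 : krull_dim R1 k1) (hk2 : krull_dim R2 k2)
  (lt1 : (k1 < n1)%N) (lt2 : (k2 < n2)%N) :
  exists d : nat, krull_dim T d /\ (d <= minn (k1 + n2) (k2 + n1) - 1)%N.
Proof.
have [co1 Hco1] := row_coords n1; have [co2 Hco2] := row_coords n2.
have [kd1 _] := hk1; have [kd2 _] := hk2.
have b1 := kdim_tensor_le H1 H2 HT Hco1 Hco2 kd1 kd2 lt1.
(* The bound on the other side of the minimum comes from exchanging the two factors. *)
have b2 := kdim_tensor_le H2 H1 (twisted_swap HT) Hco2 Hco1 kd2 kd1 lt2.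
have [d dT dle] : exists2 d, krull_dim T d & (d <= minn (k1 + n2) (k2 + n1) - 1)%N.
  apply: kdim_exists; case: (leqP (k1 + n2) (k2 + n1)) => _.
    by apply: kdim_le_leq b2; lia.
  by apply: kdim_le_leq b1; lia.
by exists d.
Qed.
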